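(* (i) Let $(P,\beta_\rhd,\beta_\lhd)$ be a Zinbiel-dendriform coalgebra and $(Q=\bigoplus_{i\in\mathbb Z}Q_i,\vartheta)$ a completed Leibniz coalgebra. Define a linear map $\delta:P\otimes Q\to(P\otimes Q)\hat\otimes(P\otimes Q)$ by $$\delta(a\otimes x)=\beta_\rhd(a)\bullet\vartheta(x)-\tau\beta_\lhd(a)\bullet\hat\tau\vartheta(x)=\sum_{(a)}\sum_{i,j,\alpha}\Big((a_1\otimes x_{1,i,\alpha})\otimes(a_2\otimes x_{2,j,\alpha})-(a_{(2)}\otimes x_{2,j,\alpha})\otimes(a_{(1)}\otimes x_{1,i,\alpha})\Big)$$ for $a\in P$, $x\in Q$, where $\beta_\rhd(a)=\sum_{(a)}a_1\otimes a_2$, $\beta_\lhd(a)=\sum_{(a)}a_{(1)}\otimes a_{(2)}$, $\vartheta(x)=\sum_{i,j,\alpha}x_{1,i,\alpha}\otimes x_{2,j,\alpha}$. Then $(P\otimes Q,\delta)$ is a completed pre-Lie coalgebra. (ii) Moreover, let $P$ be a vector space with two linear maps $\beta_\rhd,\beta_\lhd:P\to P\otimes P$, and let $(Q,\vartheta)$ be the completed Leibniz coalgebra $Q=\bigoplus_{n\in\mathbb Z}W\otimes t^n$, $W$ with basis $\varepsilon_1,\dots,\varepsilon_4$, given (writing $\varepsilon_kt^n=\varepsilon_k\otimes t^n$) by $$\vartheta(\varepsilon_1t^n)=\sum_{i+j=n}\big(\varepsilon_1t^i\otimes\varepsilon_4t^j-\varepsilon_4t^i\otimes\varepsilon_1t^j\big),\quad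 \vartheta(\varepsilon_2t^n)=\sum_{i+j=n}\big(\varepsilon_1t^i\otimes\varepsilon_3t^j+2\varepsilon_1t^i\otimes\varepsilon_4t^j-\varepsilon_4t^i\otimes\varepsilon_1t^j\big),$$ $$\vartheta(\varepsilon_3t^n)=\sum_{i+j=n}\big(\varepsilon_4t^i\otimes\varepsilon_3t^j+\varepsilon_4t^i\otimes\varepsilon_4t^j\big),\quad \vartheta(\varepsilon_4t^n)=0.$$ Then $P\otimes Q$ with $\delta$ given by the same formula is a completed pre-Lie coalgebra if and only if $(P,\beta_\rhd,\beta_\lhd)$ is a Zinbiel-dendriform coalgebra.
   Context: All vector spaces are over a field $\mathbb K$; $\tau$ is the flip, $I$ the identity. (Co)algebras are finite-dimensional except $\mathbb Z$-graded ones. Completed tensor products: for $\mathbb Z$-graded $U=\bigoplus U_i$, $V=\bigoplus V_j$, $U\hat\otimes V:=\prod_{i,j}U_i\otimes V_j$ (similarly for three factors); elements are formal sums $\sum_{i,j,\alpha}u_{i,\alpha}\otimes v_{j,\alpha}$ with finitely many $\alpha$ for each $(i,j)$; linear maps and the flip ($\hat\tau$) are extended termwise, composites being understood to be well defined (each homogeneous component a finite sum). $P$ is in degree $0$, $P\otimes Q=\bigoplus_iP\otimes Q_i$. $(a_1\otimes a_2)\bullet(x_1\otimes x_2)=(a_1\otimes x_1)\otimes(a_2\otimes x_2)$, extended linearly to formal sums. Zinbiel-dendriform coalgebra $(P,\beta_\rhd,\beta_\lhd)$: linear maps $P\to P\otimes P$ with $(I\otimes\beta_\rhd)\beta_\rhd=(\tau\otimes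 I)(I\otimes\beta_\rhd)\beta_\rhd=((\beta_\rhd+\tau\beta_\rhd+\beta_\lhd+\tau\beta_\lhd)\otimes I)\beta_\rhd$ and $(I\otimes(\beta_\rhd+\beta_\lhd))\beta_\lhd=(\beta_\lhd\otimes I)\beta_\lhd+(\tau\otimes I)(\beta_\rhd\otimes I)\beta_\lhd=(\tau\otimes I)(I\otimes\beta_\lhd)\beta_\rhd$. Completed Leibniz coalgebra $(Q,\vartheta)$: $Q=\bigoplus_iQ_i$ with all $Q_i$ finite-dimensional, $\vartheta:Q\to Q\hat\otimes Q$ linear with $(I\hat\otimes\vartheta)\vartheta=(\vartheta\hat\otimes I)\vartheta+(\hat\tau\hat\otimes I)(I\hat\otimes\vartheta)\vartheta$. Completed pre-Lie coalgebra $(L,\delta)$: $L=\bigoplus L_i$, $\delta:L\to L\hat\otimes L$ linear with $(I\hat\otimes\delta)\delta-(\hat\tau\hat\otimes I)(I\hat\otimes\delta)\delta=(\delta\hat\otimes I)\delta-(\hat\tau\hat\otimes I)(\delta\hat\otimes I)\delta$. *)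

(* Defs.v *)
From HB Require Import structures.
From mathcomp Require Import all_boot all_order all_algebra.
From mathcomp Require Import all_classical.

Set Implicit Arguments.
Unset Strict Implicit.
Unset Printing Implicit Defensive.

Import GRing.Theory.
Local Open Scope classical_set_scope.
Local Open Scope ring_scope.
Local Open Scope quotient_scope.

Reserved Notation "u \ox v" (at level 40, no associativity).

(* An element of the tensor product is the class of a finite list
   [(u1, v1); ..; (un, vn)], standing for u1 \ox v1 + .. + un \ox vn, modulo the
   congruence generated by commutativity of the sum and by bilinearity. *)
Section TensorProduct.
Variables (K : fieldType) (U V : lmodType K).

Inductive tensor_rel : seq (U * V) -> seq (U * V) -> Prop :=
| tensor_rel_refl s : tensor_rel s s
| tensor_rel_sym s t : tensor_rel s t -> tensor_rel t s
| tensor_rel_trans s t r : tensor_rel s t -> tensor_rel t r -> tensor_rel s r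
| tensor_rel_cat s s' t t' :
    tensor_rel s s' -> tensor_rel t t' -> tensor_rel (s ++ t) (s' ++ t')
| tensor_rel_comm s t : tensor_rel (s ++ t) (t ++ s)
| tensor_rel_0 v : tensor_rel [:: (0, v)] [::]
| tensor_rel_Dl u u' v : tensor_rel [:: (u + u', v)] [:: (u, v); (u', v)]
| tensor_rel_Dr u v v' : tensor_rel [:: (u, v + v')] [:: (u, v); (u, v')]
| tensor_rel_Z c u v : tensor_rel [:: (c *: u, v)] [:: (u, c *: v)].

Definition tensor_relb s t := `[< tensor_rel s t >].

Lemma tensor_relb_refl : reflexive tensor_relb.
Proof. by move=> s; apply/asboolP; exact: tensor_rel_refl. Qed.

Lemma tensor_relb_sym : symmetric tensor_relb.
Proof.
by move=> s t; apply/idP/idP => /asboolP h; apply/asboolP/tensor_rel_sym.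
Qed.

Lemma tensor_relb_trans : transitive tensor_relb.
Proof.
move=> t s r /asboolP h /asboolP h'; apply/asboolP.
exact: tensor_rel_trans h h'.
Qed.

Canonical tensor_equiv :=
  EquivRel tensor_relb tensor_relb_refl tensor_relb_sym tensor_relb_trans.

Definition tensor := {eq_quot tensor_equiv}.
HB.instance Definition _ := Choice.on tensor.

Definition tensor_of (s : seq (U * V)) : tensor := \pi_tensor s.

Lemma tensor_ofP s t : tensor_rel s t -> tensor_of s = tensor_of t.
Proof. by move=> h; apply/eqmodP/asboolP. Qed.

Lemma tensor_of_inj s t : tensor_of s = tensor_of t -> tensor_rel s t.
Proof. by move/eqmodP/asboolP. Qed.

Lemma tensor_reprK (x : tensor) : tensor_of (repr x) = x.
Proof. exact: reprK. Qed.

Lemma tensor_repr_rel s : tensor_rel (repr (tensor_of s)) s.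
Proof. by apply: tensor_of_inj; rewrite tensor_reprK. Qed.

Definition tensor_add (x y : tensor) := tensor_of (repr x ++ repr y).
Definition tensor_scale c (x : tensor) :=
  tensor_of [seq (c *: p.1, p.2) | p <- repr x].
Definition tensor_opp (x : tensor) := tensor_scale (-1) x.

Lemma tensor_addE s t : tensor_add (tensor_of s) (tensor_of t) = tensor_of (s ++ t).
Proof. by apply/tensor_ofP/tensor_rel_cat; exact: tensor_repr_rel. Qed.

Lemma tensor_rel_scale c s t : tensor_rel s t ->
  tensor_rel [seq (c *: p.1, p.2) | p <- s] [seq (c *: p.1, p.2) | p <- t].
Proof.
elim=> {s t} /= [s|s t _|s t r _ h1 _ h2|s s' t t' _ h1 _ h2|s t|v|u u' v|u v v'|d u v].
- exact: tensor_rel_refl.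
- exact: tensor_rel_sym.
- exact: tensor_rel_trans h1 h2.
- by rewrite !map_cat; exact: tensor_rel_cat.
- by rewrite !map_cat; exact: tensor_rel_comm.
- by rewrite scaler0; exact: tensor_rel_0.
- by rewrite scalerDr; exact: tensor_rel_Dl.
- exact: tensor_rel_Dr.
- by rewrite scalerA mulrC -scalerA; exact: tensor_rel_Z.
Qed.

Lemma tensor_scaleE c s :
  tensor_scale c (tensor_of s) = tensor_of [seq (c *: p.1, p.2) | p <- s].
Proof. by apply/tensor_ofP/tensor_rel_scale/tensor_repr_rel. Qed.

Lemma tensor_ind (A : tensor -> Prop) : (forall s, A (tensor_of s)) -> forall x, A x.
Proof. by move=> h x; rewrite -(tensor_reprK x). Qed.

Lemma tensor_addA : associative tensor_add.
Proof.
by do 3![elim/tensor_ind=> ?]; rewrite !tensor_addE catA.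
Qed.

Lemma tensor_addC : commutative tensor_add.
Proof.
by do 2![elim/tensor_ind=> ?]; rewrite !tensor_addE; exact/tensor_ofP/tensor_rel_comm.
Qed.

Lemma tensor_add0 : left_id (tensor_of [::]) tensor_add.
Proof. by elim/tensor_ind=> ?; rewrite tensor_addE. Qed.

Lemma tensor_rel_scaleDl a b s :
  tensor_rel [seq ((a + b) *: p.1, p.2) | p <- s]
    ([seq (a *: p.1, p.2) | p <- s] ++ [seq (b *: p.1, p.2) | p <- s]).
Proof.
elim: s => [|[u v] s ih] /=; first exact: tensor_rel_refl.
rewrite scalerDl -cat1s.
apply: tensor_rel_trans (tensor_rel_cat (tensor_rel_Dl _ _ _) ih) _ => /=.
rewrite -[_ :: (b *: u, v) :: _]cat1s -[_ :: _ ++ _ in X in tensor_rel _ X]cat1s.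
apply: tensor_rel_cat; first exact: tensor_rel_refl.
rewrite -[(b *: u, v) :: _ in X in tensor_rel X]cat1s.
rewrite -[(b *: u, v) :: _ in X in tensor_rel _ X]cat1s !catA.
by apply: tensor_rel_cat; [exact: tensor_rel_comm|exact: tensor_rel_refl].
Qed.

Lemma tensor_scaleDl x : {morph tensor_scale^~ x : a b / a + b >-> tensor_add a b}.
Proof.
move=> a b /=; elim/tensor_ind: x => s; rewrite !tensor_scaleE tensor_addE.
exact/tensor_ofP/tensor_rel_scaleDl.
Qed.

Lemma tensor_scale0 x : tensor_scale 0 x = tensor_of [::].
Proof.
elim/tensor_ind: x => s; rewrite tensor_scaleE; apply: tensor_ofP.
elim: s => [|[u v] s ih] /=; first exact: tensor_rel_refl.
by rewrite scale0r -cat1s -[[::]]cat0s; exact: tensor_rel_cat (tensor_rel_0 _) ih.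
Qed.

Lemma tensor_scale1 : left_id 1 tensor_scale.
Proof.
elim/tensor_ind=> s; rewrite tensor_scaleE; congr tensor_of.
by rewrite -[RHS]map_id; apply: eq_map => -[u v] /=; rewrite scale1r.
Qed.

Lemma tensor_addN : left_inverse (tensor_of [::]) tensor_opp tensor_add.
Proof.
move=> x; rewrite -{2}[x]tensor_scale1 /tensor_opp -tensor_scaleDl.
by rewrite addNr tensor_scale0.
Qed.

HB.instance Definition _ := GRing.isZmodule.Build tensor
  tensor_addA tensor_addC tensor_add0 tensor_addN.

Lemma tensor_scaleA a b x : tensor_scale a (tensor_scale b x) = tensor_scale (a * b) x.
Proof.
elim/tensor_ind: x => s; rewrite !tensor_scaleE -map_comp; congr tensor_of.
by apply: eq_map => -[u v] /=; rewrite scalerA.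
Qed.

Lemma tensor_scaleDr : right_distributive tensor_scale +%R.
Proof.
move=> c; do 2![elim/tensor_ind=> ?].
by rewrite [X in tensor_scale c X]tensor_addE !tensor_scaleE map_cat; symmetry; exact: tensor_addE.
Qed.

HB.instance Definition _ := GRing.Zmodule_isLmodule.Build K tensor
  tensor_scaleA tensor_scale1 tensor_scaleDr tensor_scaleDl.

Definition pure (u : U) (v : V) : tensor := tensor_of [:: (u, v)].

End TensorProduct.

Notation "u \ox v" := (pure u v) : ring_scope.

(* The linear map induced on the tensor product by a bilinear map f; for f
   not bilinear the value depends on the chosen representative. *)
Definition tlift (K : fieldType) (U V W : lmodType K) (f : U -> V -> W)
  (x : tensor U V) : W := \sum_(p <- repr x) f p.1 p.2.

Section TensorTheory.
Variables (K : fieldType) (U V W : lmodType K).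

Lemma tensor_of_cons u v (s : seq (U * V)) :
  tensor_of ((u, v) :: s) = u \ox v + tensor_of s.
Proof. by rewrite -cat1s; symmetry; exact: tensor_addE. Qed.

Lemma tensor_span (x : tensor U V) : x = \sum_(p <- repr x) p.1 \ox p.2.
Proof.
rewrite -[LHS]tensor_reprK; elim: (repr x) => [|[u v] s ih]; first by rewrite big_nil.
by rewrite big_cons tensor_of_cons ih.
Qed.

Lemma pureDl u u' (v : V) : (u + u' : U) \ox v = u \ox v + u' \ox v.
Proof.
by transitivity (tensor_of [:: (u, v); (u', v)]);
  [exact/tensor_ofP/tensor_rel_Dl | rewrite tensor_of_cons].
Qed.

Lemma pureDr (u : U) (v v' : V) : u \ox (v + v') = u \ox v + u \ox v'.
Proof.
by transitivity (tensor_of [:: (u, v); (u, v')]);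
  [exact/tensor_ofP/tensor_rel_Dr | rewrite tensor_of_cons].
Qed.

Lemma pureZl c (u : U) (v : V) : (c *: u) \ox v = c *: (u \ox v).
Proof. by symmetry; exact: tensor_scaleE. Qed.

Lemma pureZr c (u : U) (v : V) : u \ox (c *: v) = c *: (u \ox v).
Proof. by rewrite -pureZl; symmetry; exact/tensor_ofP/tensor_rel_Z. Qed.

Lemma pure0r (u : U) : u \ox (0 : V) = 0.
Proof. by rewrite -(scale0r (0 : V)) pureZr scale0r. Qed.

Section Lift.
Variable f : U -> V -> W.
Hypothesis fl : forall v, linear (f^~ v).
Hypothesis fr : forall u, linear (f u).

Let f0l v : f 0 v = 0.
Proof. by have := fl v (-1) 0 0; rewrite /= scaler0 addr0 scaleN1r addNr. Qed.

Lemma tlift_tensor_of s : tlift f (tensor_of s) = \sum_(p <- s) f p.1 p.2.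
Proof.
rewrite /tlift; have := tensor_repr_rel s; move: (repr _) => t.
elim=> {s t} /= [s|s t _|s t r _ h1 _ h2|s s' t t' _ h1 _ h2|s t|v|u u' v|u v v'|d u v] //.
- by rewrite h1 h2.
- by rewrite !big_cat /= h1 h2.
- by rewrite !big_cat /= addrC.
- by rewrite big_seq1 big_nil f0l.
- by rewrite big_seq1 big_cons big_seq1 /= -[u]scale1r fl !scale1r.
- by rewrite big_seq1 big_cons big_seq1 /= -[v]scale1r fr !scale1r.
- rewrite !big_seq1 /=.
  have -> : f (d *: u) v = d *: f u v by have := fl v d u 0; rewrite /= f0l !addr0.
  have fr0 : f u 0 = 0 by have := fr u (-1) 0 0; rewrite /= scaler0 addr0 scaleN1r addNr.
  by have := fr u d v 0; rewrite /= fr0 !addr0 => ->.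
Qed.

Lemma tlift_pure u v : tlift f (u \ox v) = f u v.
Proof. by rewrite tlift_tensor_of big_seq1. Qed.

Lemma tlift_linear : linear (tlift f).
Proof.
move=> c; elim/tensor_ind=> s; elim/tensor_ind=> t.
have -> : c *: tensor_of s + tensor_of t =
    tensor_of ([seq (c *: p.1, p.2) | p <- s] ++ t).
  by rewrite -tensor_addE -tensor_scaleE.
rewrite !tlift_tensor_of big_cat big_map /= scaler_sumr; congr (_ + _).
apply: eq_bigr => -[u v] _ /=.
by have := fl v c u 0; rewrite /= f0l !addr0.
Qed.
End Lift.

Lemma tlift_ext (f g : U -> V -> W) : f =2 g -> tlift f =1 tlift g.
Proof. by move=> h x; apply: eq_bigr => p _. Qed.

End TensorTheory.

Section TensorMaps.
Variable K : fieldType.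
Implicit Types U V W X Y P : lmodType K.

Definition tswap U V : tensor U V -> tensor V U := tlift (fun u v => v \ox u).

Definition tmap U V X Y (f : U -> X) (g : V -> Y) : tensor U V -> tensor X Y :=
  tlift (fun u v => f u \ox g v).

Definition tassoc U V W : tensor U (tensor V W) -> tensor (tensor U V) W :=
  tlift (fun u => tlift (fun v w => (u \ox v) \ox w)).

(* Threefold tensor products are bracketed to the left, so that f (x) I is
   tmapl f, while I (x) f is composed with the associativity isomorphism. *)
Definition tmapl U V X Y (f : U -> tensor X Y) :
  tensor U V -> tensor (tensor X Y) V := tmap f idfun.

Definition tmapr U V X Y (f : V -> tensor X Y) (x : tensor U V) :
  tensor (tensor U X) Y := tassoc (tmap idfun f x).

Definition tswap12 U V W : tensor (tensor U V) W -> tensor (tensor V U) W :=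
  tmap (@tswap U V) idfun.

Definition tbullet P X Y (s : tensor P P) (t : tensor X Y) :
    tensor (tensor P X) (tensor P Y) :=
  tlift (fun a1 a2 => tlift (fun x1 x2 => (a1 \ox x1) \ox (a2 \ox x2)) t) s.

End TensorMaps.

Section Bilinearity.
Variable K : fieldType.
Implicit Types U V W X Y P : lmodType K.

Lemma pure_linearl U V (v : V) : linear (fun u : U => u \ox v).
Proof. by move=> c u u'; rewrite pureDl pureZl. Qed.

Lemma pure_linearr U V (u : U) : linear (fun v : V => u \ox v).
Proof. by move=> c v v'; rewrite pureDr pureZr. Qed.

Lemma tswap_pure U V (u : U) (v : V) : tswap (u \ox v) = v \ox u.
Proof. by apply: tlift_pure => w; [exact: pure_linearr|exact: pure_linearl]. Qed.

Lemma tswap_linear U V : linear (@tswap K U V).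
Proof. by apply: tlift_linear => w; [exact: pure_linearr|exact: pure_linearl]. Qed.

Lemma tlift_comb U V W (f g h : U -> V -> W) c :
  (forall u v, h u v = c *: f u v + g u v) ->
  forall x, tlift h x = c *: tlift f x + tlift g x.
Proof.
move=> e x; rewrite /tlift scaler_sumr -big_split.
by apply: eq_bigr => p _; rewrite e.
Qed.

Let mid P X Y (a1 a2 : P) : tensor X Y -> tensor (tensor P X) (tensor P Y) :=
  tlift (fun x1 x2 => (a1 \ox x1) \ox (a2 \ox x2)).

Let mid_linear P X Y (a1 a2 : P) : linear (@mid P X Y a1 a2).
Proof.
apply: tlift_linear => [x2|x1] c x x'.
- by rewrite pureDr pureZr pureDl pureZl.
- by rewrite !(pureDr, pureZr).
Qed.

Let mid_linear1 P X Y (a2 : P) t : linear (fun a1 => @mid P X Y a1 a2 t).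
Proof.
by move=> c a a'; apply: tlift_comb => x1 x2; rewrite !(pureDl, pureZl).
Qed.

Let mid_linear2 P X Y (a1 : P) t : linear (fun a2 => @mid P X Y a1 a2 t).
Proof.
by move=> c a a'; apply: tlift_comb => x1 x2; rewrite pureDl pureZl pureDr pureZr.
Qed.

Lemma tbullet_linearl P X Y (t : tensor X Y) : linear (fun s : tensor P P => tbullet s t).
Proof. by apply: tlift_linear => a; [exact: (mid_linear1 a t)|exact: (mid_linear2 a t)]. Qed.

Lemma tbullet_linearr P X Y (s : tensor P P) : linear (fun t : tensor X Y => tbullet s t).
Proof. by move=> c t t'; apply: tlift_comb => a1 a2; exact: mid_linear. Qed.

Lemma tbullet_pure P X Y (a1 a2 : P) (x1 : X) (x2 : Y) :
  tbullet (a1 \ox a2) (x1 \ox x2) = (a1 \ox x1) \ox (a2 \ox x2).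
Proof.
rewrite /tbullet tlift_pure => [|a|a]; [|exact: mid_linear1|exact: mid_linear2].
apply: tlift_pure => [y|x] c z z'.
- by rewrite pureDr pureZr pureDl pureZl.
- by rewrite !(pureDr, pureZr).
Qed.

End Bilinearity.

Section Product.
Variables (K : fieldType) (I : Type) (M : I -> lmodType K).

Definition dprod := forall i, M i.
HB.instance Definition _ := Choice.copy dprod (forall i, M i).
Identity Coercion dprod_fun : dprod >-> Funclass.

Implicit Types f g h : dprod.

Lemma dprodP f g : (forall i, f i = g i) -> f = g.
Proof. exact: functional_extensionality_dep. Qed.

Definition dprod0 : dprod := fun i => 0.
Definition dprodN f : dprod := fun i => - f i.
Definition dprodD f g : dprod := fun i => f i + g i.
Definition dprodZ c f : dprod := fun i => c *: f i.

Lemma dprodDA : associative dprodD.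
Proof. by move=> f g h; apply: dprodP => i; exact: addrA. Qed.
Lemma dprodDC : commutative dprodD.
Proof. by move=> f g; apply: dprodP => i; exact: addrC. Qed.
Lemma dprodD0 : left_id dprod0 dprodD.
Proof. by move=> f; apply: dprodP => i; exact: add0r. Qed.
Lemma dprodDN : left_inverse dprod0 dprodN dprodD.
Proof. by move=> f; apply: dprodP => i; exact: addNr. Qed.

HB.instance Definition _ := GRing.isZmodule.Build dprod
  dprodDA dprodDC dprodD0 dprodDN.

Lemma dprodZA a b f : dprodZ a (dprodZ b f) = dprodZ (a * b) f.
Proof. by apply: dprodP => i; exact: scalerA. Qed.
Lemma dprodZ1 : left_id 1 dprodZ.
Proof. by move=> f; apply: dprodP => i; exact: scale1r. Qed.
Lemma dprodZDr : right_distributive dprodZ +%R.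
Proof. by move=> c f g; apply: dprodP => i; exact: scalerDr. Qed.
Lemma dprodZDl f : {morph dprodZ^~ f : a b / a + b}.
Proof. by move=> a b; apply: dprodP => i; exact: scalerDl. Qed.

HB.instance Definition _ := GRing.Zmodule_isLmodule.Build K dprod
  dprodZA dprodZ1 dprodZDr dprodZDl.

End Product.

(* A Z-graded space is given by its family of homogeneous components, and
   dsum L is the space L itself, the direct sum of these components. *)
Section DirectSum.
Variables (K : fieldType) (L : int -> lmodType K).

Definition finsupp (z : dprod L) := `[< finite_set [set n | z n != 0] >].

Record dsum := DSum { dsum_val :> dprod L; _ : finsupp dsum_val }.

HB.instance Definition _ := [isSub for dsum_val].
HB.instance Definition _ := [Choice of dsum by <:].

Lemma finsupp_submod : GRing.submod_closed finsupp.
Proof.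
split=> [|c f g /asboolP ff /asboolP fg]; apply/asboolP.
  rewrite (_ : [set n | _] = set0) ?finite_set0//.
  by apply/seteqP; split => // n /=; rewrite /GRing.zero /= /dprod0 eqxx.
apply: (@sub_finite_set _ _ ([set n | f n != 0] `|` [set n | g n != 0])).
  move=> n /= h; apply/orP; apply: contraNT h.
  rewrite negb_or !negbK => /andP[/eqP f0 /eqP g0].
  by rewrite [X in X == _](_ : _ = c *: f n + g n)// f0 g0 scaler0 addr0.
by rewrite finite_setU.
Qed.

HB.instance Definition _ := GRing.isSubmodClosed.Build K (dprod L) finsupp
  finsupp_submod.
HB.instance Definition _ := [SubChoice_isSubLmodule of dsum by <:].

End DirectSum.

Section DirectSumTheory.
Variables (K : fieldType) (L : int -> lmodType K).

Lemma dsumP (y z : dsum L) : (forall n, y n = z n) -> y = z.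
Proof. by move=> h; apply: val_inj; exact: dprodP. Qed.

Lemma dsum_finite (z : dsum L) : finite_set [set n | z n != 0].
Proof. by apply/asboolP; case: z. Qed.

Lemma dsum_supp (z : dsum L) :
  exists s : seq int, uniq s /\ forall n, z n != 0 -> n \in s.
Proof.
have /finite_seqP[s sE] := dsum_finite z.
exists (undup s); split; first exact: undup_uniq.
by move=> n zn; rewrite mem_undup; have : [set` s] n by rewrite -sE.
Qed.

Lemma dsumE c (y z : dsum L) n : (c *: y + z) n = c *: y n + z n.
Proof. by []. Qed.

Definition dsum_in_val n (w : L n) : dprod L := dfwith (fun m => 0 : L m) n w.

Lemma dsum_in_subproof n (w : L n) : finsupp (dsum_in_val w).
Proof.
apply/asboolP; apply: (@sub_finite_set _ _ [set n]); last exact: finite_set1.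
move=> m /=; apply: contra_neq_eq => nm.
by rewrite /dsum_in_val dfwithout// eq_sym.
Qed.

Definition dsum_in n (w : L n) : dsum L := DSum (dsum_in_subproof w).

Lemma dsum_in_eq n (w : L n) : dsum_in w n = w.
Proof. exact: dfwithin. Qed.

Lemma dsum_in_neq n m (w : L n) : n != m -> dsum_in w m = 0.
Proof. exact: dfwithout. Qed.

Lemma dsum_in_linear n : linear (@dsum_in n).
Proof.
move=> c v w; apply: dsumP => m; rewrite dsumE; have [<-|nm] := eqVneq n m.
  by rewrite !dsum_in_eq.
by rewrite !dsum_in_neq// scaler0 addr0.
Qed.

(* The linear map on the direct sum induced by linear maps on its summands. *)
Definition dsum_lift (W : lmodType K) (f : forall n, L n -> W) (z : dsum L) : W :=
  \sum_(n \in [set: int]) f n (z n).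

Section Lift.
Variables (W : lmodType K) (f : forall n, L n -> W).
Arguments f : clear implicits.
Hypothesis fl : forall n, linear (f n).
Arguments fl : clear implicits.

Let f0 n : f n 0 = 0.
Proof. by have := fl n (-1) 0 0; rewrite /= scaler0 addr0 scaleN1r addNr. Qed.

Lemma dsum_lift_seq (z : dsum L) (s : seq int) : uniq s ->
  (forall n, z n != 0 -> n \in s) -> dsum_lift f z = \sum_(n <- s) f n (z n).
Proof.
move=> us h; rewrite /dsum_lift [RHS]fsbig_seq//; symmetry.
apply: fsbig_widen => // n [_ /= ns].
have [->|/h zn] := eqVneq (z n) 0; first exact: f0.
by case: ns.
Qed.

Lemma dsum_lift_linear : linear (dsum_lift f).
Proof.
move=> c y z.
have [sy0 [_ sy]] := dsum_supp y; have [sz0 [_ sz]] := dsum_supp z.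
pose s := undup (sy0 ++ sz0); have us : uniq s by exact: undup_uniq.
have {}sy n : y n != 0 -> n \in s by move/sy; rewrite mem_undup mem_cat => ->.
have {}sz n : z n != 0 -> n \in s.
  by move/sz; rewrite mem_undup mem_cat orbC => ->.
rewrite (dsum_lift_seq us sy) (dsum_lift_seq us sz) (@dsum_lift_seq _ s)//.
  rewrite scaler_sumr -big_split; apply: eq_bigr => n _.
  by rewrite dsumE fl.
move=> n; rewrite dsumE; apply: contraR => ns.
have -> : y n = 0 by apply: contraNeq ns; exact: sy.
have -> : z n = 0 by apply: contraNeq ns; exact: sz.
by rewrite scaler0 addr0.
Qed.

Lemma dsum_lift_in n (w : L n) : dsum_lift f (dsum_in w) = f n w.
Proof.
rewrite (@dsum_lift_seq _ [:: n])//; first by rewrite big_seq1 dsum_in_eq.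
move=> m; rewrite inE; apply: contraR => nm.
by rewrite dsum_in_neq// eq_sym.
Qed.
End Lift.

Lemma dsum_decomp (z : dsum L) : z = dsum_lift (fun n => @dsum_in n) z.
Proof.
have [s [us sz]] := dsum_supp z.
rewrite (dsum_lift_seq (fun n => @dsum_in_linear n) us sz).
apply: dsumP => n.
have evalE (r : seq int) (g : int -> dsum L) :
    (\sum_(m <- r) g m : dsum L) n = \sum_(m <- r) g m n.
  by elim: r => [|m r ih]; rewrite ?big_nil// !big_cons -ih.
rewrite evalE; have [ns|ns] := boolP (n \in s).
  rewrite (bigD1_seq n)// dsum_in_eq big1 => [|m mn]; first by rewrite /= addr0.
  by rewrite dsum_in_neq.
rewrite big_seq big1 => [|m ms]; first by apply: contraNeq ns; exact: sz.
by rewrite dsum_in_neq//; apply: contraNneq ns => <-.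
Qed.
End DirectSumTheory.

Section Completed.
Variable K : fieldType.
Implicit Types U V W L : int -> lmodType K.

Definition ctensor U V : lmodType K :=
  dprod (fun i => dprod (fun j => tensor (U i) (V j))).

Definition ctensor3 U V W : lmodType K :=
  dprod (fun i => dprod (fun j => dprod (fun k =>
    tensor (tensor (U i) (V j)) (W k)))).

Definition cswap U V (z : ctensor U V) : ctensor V U := fun i j => tswap (z j i).

Definition cswap12 U V W (z : ctensor3 U V W) : ctensor3 V U W :=
  fun i j k => tswap12 (z j i k).

Section Coproduct.
Variables (L : int -> lmodType K) (d : {linear dsum L -> ctensor L L}).

(* The contribution of the (i, l) component of z to the (i, j, k) component of
   (I (x) d) z, and of its (l, k) component to that of (d (x) I) z. *)
Definition ctermr (z : ctensor L L) i j k l :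
    tensor (tensor (L i) (L j)) (L k) :=
  tmapr (fun v : L l => d (dsum_in v) j k) (z i l).

Definition cterml (z : ctensor L L) i j k l :
    tensor (tensor (L i) (L j)) (L k) :=
  tmapl (fun u : L l => d (dsum_in u) i j) (z l k).

Definition cmapr (z : ctensor L L) : ctensor3 L L L :=
  fun i j k => \sum_(l \in [set: int]) ctermr z i j k l.

Definition cmapl (z : ctensor L L) : ctensor3 L L L :=
  fun i j k => \sum_(l \in [set: int]) cterml z i j k l.

(* Both composites (I (x) d) d and (d (x) I) d are well defined. The sums above
   are 0 by convention when infinitely many terms are nonzero, hence the need
   for this condition. *)
Definition composable := forall (x : dsum L) i j k,
  finite_set [set l | ctermr (d x) i j k l != 0] /\
  finite_set [set l | cterml (d x) i j k l != 0].

Definition completed_prelie_coalgebra := composable /\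
  forall x : dsum L,
    cmapr (d x) - cswap12 (cmapr (d x)) = cmapl (d x) - cswap12 (cmapl (d x)).

End Coproduct.

Definition completed_leibniz_coalgebra (Q : int -> vectType K)
    (theta : {linear dsum (fun n => Q n) -> ctensor (fun n => Q n) (fun n => Q n)}) :=
  composable theta /\
  forall x, cmapr theta (theta x) =
    cmapl theta (theta x) + cswap12 (cmapr theta (theta x)).

Definition zinbiel_dendriform_coalgebra (P : lmodType K)
    (br bl : {linear P -> tensor P P}) :=
  forall a : P,
  [/\ tmapr br (br a) = tswap12 (tmapr br (br a)),
      tmapr br (br a) =
        tmapl (fun b => br b + tswap (br b) + bl b + tswap (bl b)) (br a),
      tmapr (fun b => br b + bl b) (bl a) =
        tmapl bl (bl a) + tswap12 (tmapl br (bl a)) &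
      tmapr (fun b => br b + bl b) (bl a) = tswap12 (tmapr bl (br a))].

End Completed.

Section TensorCoproduct.
Variables (K : fieldType) (P : lmodType K) (Q : int -> lmodType K).

Definition gtensor : int -> lmodType K := fun n => tensor P (Q n).

Lemma gpure_subproof (a : P) (x : dsum Q) :
  finsupp ((fun n => a \ox x n) : dprod gtensor).
Proof.
apply/asboolP; apply: sub_finite_set (dsum_finite x) => n /=.
by apply: contra_neq => ->; exact: pure0r.
Qed.

Definition gpure (a : P) (x : dsum Q) : dsum gtensor := DSum (gpure_subproof a x).

Definition bullet (s : tensor P P) (z : ctensor Q Q) : ctensor gtensor gtensor :=
  fun i j => tbullet s (z i j).

Variables (br bl : {linear P -> tensor P P}).
Variable theta : {linear dsum Q -> ctensor Q Q}.

Definition tensor_coproduct_pure (a : P) (x : dsum Q) : ctensor gtensor gtensor :=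
  bullet (br a) (theta x) - bullet (tswap (bl a)) (cswap (theta x)).

(* The linear extension of tensor_coproduct_pure, see tensor_coproductE. *)
Definition tensor_coproduct : dsum gtensor -> ctensor gtensor gtensor :=
  dsum_lift (fun n => tlift (fun a (x : Q n) => tensor_coproduct_pure a (dsum_in x))).

Lemma bullet_linearl z : linear (bullet^~ z).
Proof.
move=> c s t; apply: dprodP => i; apply: dprodP => j; exact: tbullet_linearl.
Qed.

Lemma bullet_linearr s : linear (bullet s).
Proof.
move=> c y z; apply: dprodP => i; apply: dprodP => j; exact: tbullet_linearr.
Qed.

Lemma cswap_linear (U V : int -> lmodType K) : linear (@cswap K U V).
Proof. by move=> c y z; apply: dprodP => i; apply: dprodP => j; exact: tswap_linear. Qed.

Lemma tensor_coproduct_pure_linearl x : linear (tensor_coproduct_pure^~ x).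
Proof.
move=> c a b; rewrite /tensor_coproduct_pure !linearP tswap_linear !bullet_linearl.
by rewrite scalerBr opprD addrACA.
Qed.

Lemma tensor_coproduct_pure_linearr a : linear (tensor_coproduct_pure a).
Proof.
move=> c x y; rewrite /tensor_coproduct_pure linearP cswap_linear !bullet_linearr.
by rewrite scalerBr opprD addrACA.
Qed.

Let lin_in_l n (x : Q n) :
  linear (fun a => tensor_coproduct_pure a (dsum_in x)).
Proof. exact: tensor_coproduct_pure_linearl. Qed.

Let lin_in_r n (a : P) :
  linear (fun x : Q n => tensor_coproduct_pure a (dsum_in x)).
Proof.
by move=> c x y; rewrite dsum_in_linear tensor_coproduct_pure_linearr.
Qed.

Let lin_n n : linear
  (tlift (fun a (x : Q n) => tensor_coproduct_pure a (dsum_in x))).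
Proof. by apply: tlift_linear => [x|a]; [exact: lin_in_l|exact: lin_in_r]. Qed.

Lemma tensor_coproduct_linear : linear tensor_coproduct.
Proof. exact: dsum_lift_linear. Qed.

HB.instance Definition _ := GRing.isLinear.Build K _ _ _ tensor_coproduct
  tensor_coproduct_linear.

Lemma tensor_coproductE a x : tensor_coproduct (gpure a x) =
  bullet (br a) (theta x) - bullet (tswap (bl a)) (cswap (theta x)).
Proof.
have [s [us sx]] := dsum_supp x.
rewrite /tensor_coproduct (dsum_lift_seq lin_n us) => [|n]; last first.
  move=> h; apply: sx; apply: contra_neq h => /= ->.
  exact: pure0r.
transitivity (\sum_(n <- s) tensor_coproduct_pure a (dsum_in (x n))).
  apply: eq_bigr => n _ /=; apply: tlift_pure; [exact: lin_in_l|exact: lin_in_r].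
rewrite -[RHS]/(tensor_coproduct_pure a x) {2}[x]dsum_decomp.
rewrite (dsum_lift_seq (fun n => @dsum_in_linear _ _ n) us sx).
pose F := GRing.isLinear.Build K _ _ _ (tensor_coproduct_pure a)
  (tensor_coproduct_pure_linearr a).
pose G : {linear _ -> _} := HB.pack (tensor_coproduct_pure a) F.
by rewrite -[RHS]/(G _) raddf_sum.
Qed.

End TensorCoproduct.

Section LaurentSpace.
Variables (K : fieldType) (W : vectType K).

(* The graded space with components W t^n, each identified with W. *)
Definition laurent : int -> vectType K := fun=> W.

Definition monomial (w : W) (n : int) : dsum (fun n => laurent n) :=
  @dsum_in K (fun n => laurent n) n w.

(* The formal sum over all i + j = n of the copies in (W t^i) \ox (W t^j) of
   the tensor w. *)
Definition antidiagonal (w : tensor W W) (n : int) :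
    ctensor (fun n => laurent n) (fun n => laurent n) :=
  fun i j => if i + j == n then w else 0.

Lemma laurent_coproduct_exists m (X : m.-tuple W) (w : 'I_m -> tensor W W) :
  basis_of fullv X ->
  exists theta : {linear dsum (fun n => laurent n) ->
                         ctensor (fun n => laurent n) (fun n => laurent n)},
  forall (k : 'I_m) n, theta (monomial X`_k n) = antidiagonal (w k) n.
Proof.
move=> bX; pose f n (v : laurent n) : ctensor (fun n => laurent n) (fun n => laurent n) :=
  \sum_k coord X k v *: antidiagonal (w k) n.
have fl n : linear (@f n).
  move=> c u v; rewrite /f scaler_sumr -big_split; apply: eq_bigr => k _ /=.
  by rewrite linearP scalerDl scalerA.
pose F := GRing.isLinear.Build K _ _ _ (dsum_lift f) (dsum_lift_linear fl).
exists (HB.pack (dsum_lift f) F : {linear _ -> _}) => k n.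
rewrite /monomial [LHS]dsum_lift_in// /f (bigD1 k)//= big1 ?addr0 => [|j jk].
  by rewrite coord_free ?(basis_free bX)// eqxx scale1r.
by rewrite coord_free ?(basis_free bX)// eq_sym (negPf jk) scale0r.
Qed.

End LaurentSpace.

(* Main.v *)
(* Write R = (I (x) theta) theta and L = (theta (x) I) theta. By the Leibniz
   identity, L = R - (tau (x) I) R, so both sides of the pre-Lie identity for
   delta on a (x) x become sums, over the six permutations pi of the tensor
   factors, of an element of P^{(x) 3} paired with pi R. Comparing the
   coefficients of the six pi R gives, up to permutation, three equations, which
   are together equivalent to the Zinbiel-dendriform identities. For the
   coalgebra of (ii), the degree (0, 0, 0) component of R (e2 t^0) is the sum of
   e1 (x) e4 (x) e3 and of terms in which e4 occurs twice, so contraction with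
   the dual basis vectors of e1, e4, e3, taken in three different orders,
   isolates the three equations. *)
From HB Require Import structures.
Require Import Defs.
From mathcomp Require Import all_boot all_order all_algebra.
From mathcomp Require Import all_classical.

Set Implicit Arguments.
Unset Strict Implicit.
Unset Printing Implicit Defensive.

Import GRing.Theory.
Local Open Scope ring_scope.

(** * Linear maps given by a linearity predicate *)

Section LinearPredicate.
Variables (K : fieldType) (U V : lmodType K) (f : U -> V).
Hypothesis fL : linear f.

(** Maps such as [tmapr f] are linear only under a hypothesis on [f] and carry no bundled structure;
    packing the proof makes the general facts on linear maps available for them. *)
Definition linear_pack : {linear U -> V} :=
  HB.pack f (GRing.isLinear.Build K U V *:%R f fL).

Lemma linear_0 : f 0 = 0. Proof. exact: (linear0 linear_pack). Qed.
Lemma linear_D : {morph f : x y / x + y}. Proof. exact: (linearD linear_pack). Qed.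
Lemma linear_N : {morph f : x / - x}. Proof. exact: (linearN linear_pack). Qed.
Lemma linear_B : {morph f : x y / x - y}. Proof. exact: (linearB linear_pack). Qed.
End LinearPredicate.

(** * Threefold tensor products *)

Section TensorTools.
Variable K : fieldType.
Implicit Types U V W X Y P : lmodType K.

(** Every tensor is a finite sum of pure ones. Zero needs no case of its own, being the pure tensor
    [0 \ox 0]. *)
Lemma tensor_pure_ind U V (A : tensor U V -> Prop) :
  (forall u v, A (u \ox v)) -> (forall x y, A x -> A y -> A (x + y)) ->
  forall x, A x.
Proof.
move=> Apure AD x; rewrite (tensor_span x); elim: (repr x) => [|p s ih].
  by rewrite big_nil -(pure0r V (0 : U)).
by rewrite big_cons; apply: AD.
Qed.

Lemma tensor3_pure_ind U V W (A : tensor (tensor U V) W -> Prop) :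
  (forall u v w, A ((u \ox v) \ox w)) -> (forall x y, A x -> A y -> A (x + y)) ->
  forall x, A x.
Proof.
move=> Apure AD; apply: tensor_pure_ind => // x w.
elim/tensor_pure_ind: x => // x y Ax Ay; rewrite pureDl; exact: AD.
Qed.

Lemma pureBr U V (u : U) (v v' : V) : u \ox (v - v') = u \ox v - u \ox v'.
Proof. exact: (linear_B (pure_linearr u)). Qed.

Lemma pureNl U V (u : U) (v : V) : (- u) \ox v = - (u \ox v).
Proof. exact: (linear_N (pure_linearl v)). Qed.

Lemma pureNr U V (u : U) (v : V) : u \ox (- v) = - (u \ox v).
Proof. exact: (linear_N (pure_linearr u)). Qed.

Section Map.
Variables (U V X Y : lmodType K) (f : U -> X) (g : V -> Y).
Hypotheses (fL : linear f) (gL : linear g).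

Let tmapl_lin v : linear (fun u => f u \ox g v).
Proof. by move=> c u u'; rewrite fL pureDl pureZl. Qed.

Let tmapr_lin u : linear (fun v => f u \ox g v).
Proof. by move=> c v v'; rewrite gL pureDr pureZr. Qed.

Lemma tmap_linear : linear (tmap f g).
Proof. exact: tlift_linear. Qed.

Lemma tmap_pure u v : tmap f g (u \ox v) = f u \ox g v.
Proof. exact: tlift_pure. Qed.
End Map.

Lemma tswapD U V : {morph @tswap K U V : x y / x + y}.
Proof. exact: (linear_D (@tswap_linear K U V)). Qed.
Section Assoc.
Variables U V W : lmodType K.

Let inner_linear (u : U) :
  linear (tlift (fun (v : V) (w : W) => (u \ox v) \ox w)).
Proof.
apply: tlift_linear => [w|v] c x y; last exact: pure_linearr.
by rewrite pureDr pureZr pureDl pureZl.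
Qed.

Let outer_linear (x : tensor V W) :
  linear (fun u : U => tlift (fun (v : V) (w : W) => (u \ox v) \ox w) x).
Proof. by move=> c u u'; apply: tlift_comb => v w; rewrite !(pureDl, pureZl). Qed.

Lemma tassoc_linear : linear (@tassoc K U V W).
Proof. by apply: tlift_linear => w; [exact: outer_linear|exact: inner_linear]. Qed.

Lemma tassoc_pure (u : U) (v : V) (w : W) :
  tassoc (u \ox (v \ox w)) = (u \ox v) \ox w.
Proof.
rewrite /tassoc tlift_pure => [|y|y]; [|exact: outer_linear|exact: inner_linear].
apply: tlift_pure => [z|z] c x y; last exact: pure_linearr.
by rewrite pureDr pureZr pureDl pureZl.
Qed.
End Assoc.

Lemma tassocD U V W : {morph @tassoc K U V W : x y / x + y}.
Proof. exact: (linear_D (@tassoc_linear U V W)). Qed.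
Lemma tassocN U V W : {morph @tassoc K U V W : x / - x}.
Proof. exact: (linear_N (@tassoc_linear U V W)). Qed.
Lemma tassocB U V W : {morph @tassoc K U V W : x y / x - y}.
Proof. exact: (linear_B (@tassoc_linear U V W)). Qed.

Lemma idfun_linear U : linear (@idfun U). Proof. by []. Qed.

Lemma tmapl_pure U V X Y (f : U -> tensor X Y) (u : U) (v : V) : linear f ->
  tmapl f (u \ox v) = f u \ox v.
Proof. by move=> fL; rewrite /tmapl tmap_pure. Qed.

Lemma tmapl_linear U V X Y (f : U -> tensor X Y) :
  linear f -> linear (@tmapl K U V X Y f).
Proof. by move=> fL; apply: tmap_linear. Qed.

Lemma tmapr_pure U V X Y (f : V -> tensor X Y) (u : U) (v : V) : linear f ->
  tmapr f (u \ox v) = tassoc (u \ox f v).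
Proof. by move=> fL; rewrite /tmapr tmap_pure. Qed.

Lemma tmapr_linear U V X Y (f : V -> tensor X Y) :
  linear f -> linear (@tmapr K U V X Y f).
Proof.
move=> fL c x y.
by rewrite /tmapr (tmap_linear (@idfun_linear U) fL) tassoc_linear.
Qed.

Lemma tswap12_linear U V W : linear (@tswap12 K U V W).
Proof. exact: tmap_linear (@tswap_linear K U V) _. Qed.

Lemma tswap12D U V W : {morph @tswap12 K U V W : x y / x + y}.
Proof. exact: (linear_D (@tswap12_linear U V W)). Qed.
Lemma tswap12B U V W : {morph @tswap12 K U V W : x y / x - y}.
Proof. exact: (linear_B (@tswap12_linear U V W)). Qed.
Lemma tswap12N U V W : {morph @tswap12 K U V W : x / - x}.
Proof. exact: (linear_N (@tswap12_linear U V W)). Qed.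

Lemma tswap12_pure U V W (x : tensor U V) (w : W) :
  tswap12 (x \ox w) = tswap x \ox w.
Proof. exact: (tmap_pure (@tswap_linear K U V)). Qed.

(* The cyclic permutation u \ox v \ox w |-> w \ox u \ox v; together with
   tswap12 it generates all permutations of the three factors. *)
Definition trot U V W (x : tensor (tensor U V) W) : tensor (tensor W U) V :=
  tassoc (tswap x).

Lemma trot_linear U V W : linear (@trot U V W).
Proof. by move=> c x y; rewrite /trot tswap_linear tassoc_linear. Qed.

Lemma trotD U V W : {morph @trot U V W : x y / x + y}.
Proof. exact: (linear_D (@trot_linear U V W)). Qed.
Lemma trotB U V W : {morph @trot U V W : x y / x - y}.
Proof. exact: (linear_B (@trot_linear U V W)). Qed.
Lemma trotN U V W : {morph @trot U V W : x / - x}.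
Proof. exact: (linear_N (@trot_linear U V W)). Qed.

Lemma trot_pure U V W (u : U) (v : V) (w : W) :
  trot ((u \ox v) \ox w) = (w \ox u) \ox v.
Proof. by rewrite /trot tswap_pure tassoc_pure. Qed.

(** Identities between composites of flips and rotations are checked by evaluation on pure tensors
    with these rules, and extended to all tensors by the additivity rules [tpermD]. *)
Definition tpermE := (tswap_pure, tswap12_pure, trot_pure).

Definition tpermD := (tswapD, tassocD, tswap12D, trotD).

Lemma tswap12K U V W (x : tensor (tensor U V) W) : tswap12 (tswap12 x) = x.
Proof.
by elim/tensor3_pure_ind: x => [u v w|x y + +]; rewrite ?tpermE// !tpermD => -> ->.
Qed.

Lemma tswapK U V (x : tensor U V) : tswap (tswap x) = x.
Proof.
by elim/tensor_pure_ind: x => [u v|x y + +]; rewrite ?tpermE// !tpermD => -> ->.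
Qed.

Lemma trotK U V W (x : tensor (tensor U V) W) : trot (trot (trot x)) = x.
Proof.
by elim/tensor3_pure_ind: x => [u v w|x y + +]; rewrite ?tpermE// !tpermD => -> ->.
Qed.

(** The relation in the symmetric group on three letters that moves a transposition past a 3-cycle.
    With [tswap12K] and [trotK] it brings every word in the two generators to a normal form. *)
Lemma trot_swap12 U V W (x : tensor (tensor U V) W) :
  trot (tswap12 x) = tswap12 (trot (trot x)).
Proof.
by elim/tensor3_pure_ind: x => [u v w|x y + +]; rewrite ?tpermE// !tpermD => -> ->.
Qed.

Lemma trot_inj U V W : injective (@trot U V W).
Proof. by move=> x y e; rewrite -[x]trotK e trotK. Qed.

Lemma tswap12_inj U V W : injective (@tswap12 K U V W).
Proof. by move=> x y e; rewrite -[x]tswap12K e tswap12K. Qed.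

Section MapSwap.
Variables (U V X Y : lmodType K) (f : V -> tensor X Y).
Hypothesis fL : linear f.

(** The factor untouched by [f] stands first on the left side and last in [tmapl f x]; [trot]
    carries the last factor to the front. *)
Lemma tmapr_swap (x : tensor V U) : tmapr f (tswap x) = trot (tmapl f x).
Proof.
have lL := @tmapl_linear V U _ _ f fL; have rL := @tmapr_linear U V _ _ f fL.
elim/tensor_pure_ind: x => [u v|x y hx hy].
  by rewrite tswap_pure tmapr_pure// tmapl_pure// /trot tswap_pure.
by rewrite tpermD (linear_D rL) (linear_D lL) tpermD hx hy.
Qed.

Lemma tmapl_swap (x : tensor U V) : tmapl f (tswap x) = trot (trot (tmapr f x)).
Proof. by apply: trot_inj; rewrite trotK -tmapr_swap tswapK. Qed.

(** Flipping the output of [f] exchanges the last two of the three factors, and this transposition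
    is [trot] followed by [tswap12]. *)
Lemma tmapr_tswap (x : tensor U V) :
  tmapr (fun v => tswap (f v)) x = tswap12 (trot (tmapr f x)).
Proof.
have sL : linear (fun v => tswap (f v)) by move=> c v w; rewrite fL tswap_linear.
have sL' := @tmapr_linear U V _ _ _ sL; have fL' := @tmapr_linear U V _ _ _ fL.
elim/tensor_pure_ind: x => [u v|x y hx hy]; last first.
  by rewrite (linear_D sL') (linear_D fL') !tpermD hx hy.
rewrite !tmapr_pure//; elim/tensor_pure_ind: (f v) => [a b|a b ha hb].
  by rewrite tpermE !tassoc_pure !tpermE.
by rewrite !(pureDr, tpermD) ha hb.
Qed.

Lemma tmapl_tswap (x : tensor V U) :
  tmapl (fun v => tswap (f v)) x = tswap12 (tmapl f x).
Proof.
have sL : linear (fun v => tswap (f v)) by move=> c v w; rewrite fL tswap_linear.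
have sL' := @tmapl_linear V U _ _ _ sL; have fL' := @tmapl_linear V U _ _ _ fL.
elim/tensor_pure_ind: x => [u v|x y hx hy]; last first.
  by rewrite (linear_D sL') (linear_D fL') !tpermD hx hy.
by rewrite !tmapl_pure// tswap12_pure.
Qed.

End MapSwap.

End TensorTools.

(** * The bullet product of threefold tensors *)

Section TripleBullet.
Variables (K : fieldType) (P : lmodType K).
Implicit Types X Y Z U V : lmodType K.

(** The threefold analogue of [tbullet]. The nesting of the lifts follows the left bracketing, so
    the first two factors are left to [tbullet]. *)
Definition bullet3 X Y Z (s : tensor (tensor P P) P) (t : tensor (tensor X Y) Z) :
    tensor (tensor (tensor P X) (tensor P Y)) (tensor P Z) :=
  tlift (fun u a => tlift (fun v x => tbullet u v \ox (a \ox x)) t) s.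

Section Bilinear.
Variables X Y Z : lmodType K.

Let body_l (u : tensor P P) (a : P) (x : Z) :
  linear (fun v : tensor X Y => tbullet u v \ox (a \ox x)).
Proof. by move=> c v v'; rewrite tbullet_linearr pureDl pureZl. Qed.

Let body_r (u : tensor P P) (a : P) (v : tensor X Y) :
  linear (fun x : Z => tbullet u v \ox (a \ox x)).
Proof. by move=> c x x'; rewrite !(pureDr, pureZr). Qed.

Let inner_linear (u : tensor P P) (a : P) :
  linear (tlift (fun (v : tensor X Y) (x : Z) => tbullet u v \ox (a \ox x))).
Proof. by apply: tlift_linear => ?; [exact: body_l|exact: body_r]. Qed.

Let outer_l (a : P) (t : tensor (tensor X Y) Z) :
  linear (fun u : tensor P P =>
    tlift (fun (v : tensor X Y) (x : Z) => tbullet u v \ox (a \ox x)) t).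
Proof.
move=> c u u'; apply: tlift_comb => v x.
by rewrite tbullet_linearl pureDl pureZl.
Qed.

Let outer_r (u : tensor P P) (t : tensor (tensor X Y) Z) :
  linear (fun a : P =>
    tlift (fun (v : tensor X Y) (x : Z) => tbullet u v \ox (a \ox x)) t).
Proof.
by move=> c a a'; apply: tlift_comb => v x; rewrite pureDl pureZl pureDr pureZr.
Qed.

Lemma bullet3_linearl t : linear (fun s => @bullet3 X Y Z s t).
Proof. by apply: tlift_linear => ?; [exact: outer_l|exact: outer_r]. Qed.

Lemma bullet3_linearr s : linear (@bullet3 X Y Z s).
Proof. by move=> c t t'; apply: tlift_comb => u a; exact: inner_linear. Qed.

Lemma bullet3_pure a b c (x : X) (y : Y) (z : Z) :
  bullet3 ((a \ox b) \ox c) ((x \ox y) \ox z) =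
  ((a \ox x) \ox (b \ox y)) \ox (c \ox z).
Proof.
rewrite /bullet3 tlift_pure => [|?|?]; [|exact: outer_l|exact: outer_r].
rewrite tlift_pure => [|?|?]; [|exact: body_l|exact: body_r].
by rewrite tbullet_pure.
Qed.
End Bilinear.

Section Morphisms.
Variables X Y Z : lmodType K.
Implicit Types (s : tensor (tensor P P) P) (t : tensor (tensor X Y) Z).

Lemma bullet3Dl s s' t : bullet3 (s + s') t = bullet3 s t + bullet3 s' t.
Proof. exact: (linear_D (bullet3_linearl t)). Qed.
Lemma bullet3Dr s t t' : bullet3 s (t + t') = bullet3 s t + bullet3 s t'.
Proof. exact: (linear_D (bullet3_linearr s)). Qed.
Lemma bullet3Nr s t : bullet3 s (- t) = - bullet3 s t.
Proof. exact: (linear_N (bullet3_linearr s)). Qed.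
Lemma bullet3Br s t t' : bullet3 s (t - t') = bullet3 s t - bullet3 s t'.
Proof. exact: (linear_B (bullet3_linearr s)). Qed.

End Morphisms.

Section Permutations.
Variables X Y Z : lmodType K.
Implicit Types (s : tensor (tensor P P) P) (t : tensor (tensor X Y) Z).

(** Permuting the three factors [P \ox X], [P \ox Y], [P \ox Z] permutes their two components
    simultaneously. *)
Lemma trot_bullet3 s t : trot (bullet3 s t) = bullet3 (trot s) (trot t).
Proof.
elim/tensor3_pure_ind: s => [a b c|s s' + +]; last first.
  by rewrite !(bullet3Dl, tpermD) => -> ->.
elim/tensor3_pure_ind: t => [x y z|t t' + +]; last first.
  by rewrite !(bullet3Dr, tpermD) => -> ->.
by rewrite !(bullet3_pure, trot_pure).
Qed.

Lemma tswap12_bullet3 s t : tswap12 (bullet3 s t) = bullet3 (tswap12 s) (tswap12 t).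
Proof.
elim/tensor3_pure_ind: s => [a b c|s s' + +]; last first.
  by rewrite !(bullet3Dl, tpermD) => -> ->.
elim/tensor3_pure_ind: t => [x y z|t t' + +]; last first.
  by rewrite !(bullet3Dr, tpermD) => -> ->.
by rewrite !(bullet3_pure, tpermE).
Qed.
End Permutations.

Section MapBullet.
Variables U V X Y : lmodType K.
Variables (D : tensor P V -> tensor (tensor P X) (tensor P Y)).
Variables (g1 g2 : P -> tensor P P) (h1 h2 : V -> tensor X Y).
Hypotheses (DL : linear D) (g1L : linear g1) (g2L : linear g2).
Hypotheses (h1L : linear h1) (h2L : linear h2).
Hypothesis DE : forall a v,
  D (a \ox v) = tbullet (g1 a) (h1 v) - tbullet (g2 a) (h2 v).

Let tassoc_bullet (a : P) (x : U) (s : tensor P P) (t : tensor X Y) :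
  tassoc ((a \ox x) \ox tbullet s t) =
  bullet3 (tassoc (a \ox s)) (tassoc (x \ox t)).
Proof.
elim/tensor_pure_ind: s => [b c|s s' hs hs'].
  elim/tensor_pure_ind: t => [y z|t t' ht ht'].
    by rewrite tbullet_pure !tassoc_pure bullet3_pure.
  by rewrite (linear_D (tbullet_linearr _)) !(bullet3Dr, pureDr, tpermD) ht ht'.
by rewrite (linear_D (tbullet_linearl _)) !(bullet3Dl, pureDr, tpermD) hs hs'.
Qed.

(** [D] has the shape of one homogeneous component of the coproduct on the tensor product, with [g2]
    and [h2] in the place of the flipped maps. Both sides are additive in [s] and in [t], which
    leaves pure tensors. *)
Lemma tmapr_bullet (s : tensor P P) (t : tensor U V) :
  tmapr D (tbullet s t) =
  bullet3 (tmapr g1 s) (tmapr h1 t) - bullet3 (tmapr g2 s) (tmapr h2 t).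
Proof.
have rD := linear_D (tmapr_linear (U := tensor P U) DL).
have rg1 := linear_D (tmapr_linear (U := P) g1L).
have rg2 := linear_D (tmapr_linear (U := P) g2L).
have rh1 := linear_D (tmapr_linear (U := U) h1L).
have rh2 := linear_D (tmapr_linear (U := U) h2L).
elim/tensor_pure_ind: s => [a b|s s' hs hs'].
  elim/tensor_pure_ind: t => [x y|t t' ht ht'].
    by rewrite tbullet_pure !tmapr_pure// DE pureBr tassocB !tassoc_bullet.
  rewrite (linear_D (tbullet_linearr _)) rD ht ht' rh1 rh2 !bullet3Dr.
  by rewrite opprD addrACA.
rewrite (linear_D (tbullet_linearl _)) rD hs hs' rg1 rg2 !bullet3Dl.
by rewrite opprD addrACA.
Qed.

Lemma tmapl_bullet (s : tensor P P) (t : tensor V U) :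
  tmapl D (tbullet s t) =
  bullet3 (tmapl g1 s) (tmapl h1 t) - bullet3 (tmapl g2 s) (tmapl h2 t).
Proof.
have tswap_bullet : tswap (tbullet s t) = tbullet (tswap s) (tswap t).
  elim/tensor_pure_ind: s => [a b|s s' hs hs']; last first.
    rewrite (linear_D (tbullet_linearl _)) !tpermD hs hs'.
    by rewrite (linear_D (tbullet_linearl _)).
  elim/tensor_pure_ind: t => [x y|t t' ht ht']; last first.
    rewrite (linear_D (tbullet_linearr _)) !tpermD ht ht'.
    by rewrite (linear_D (tbullet_linearr _)).
  by rewrite !(tbullet_pure, tswap_pure).
(* A rotation turns the left map into a right map on the flipped tensor, so that [tmapr_bullet]
   applies; the rotations are then taken back out. *)
apply: trot_inj; rewrite -tmapr_swap// tswap_bullet tmapr_bullet.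
by rewrite !tmapr_swap// trotB !trot_bullet3.
Qed.
End MapBullet.
End TripleBullet.

(** * Completed tensor products *)

Local Open Scope classical_set_scope.

Section FiniteSums.
Variables (K : fieldType).
Implicit Types (V W : lmodType K).

(** A sum with infinite support has the default value 0, so its value alone shows nothing. Carrying
    the finiteness along proves [composable] and computes the composites at the same time. *)
Definition has_fsum V (F : int -> V) (v : V) :=
  finite_set [set l | F l != 0] /\ \sum_(l \in [set: int]) F l = v.

Lemma has_fsum_finite V (F : int -> V) :
  finite_set [set l | F l != 0] -> has_fsum F (\sum_(l \in [set: int]) F l).
Proof. by []. Qed.

Let has_fsumE V (A : set int) (F : int -> V) : [set l | F l != 0] `<=` A ->
  \sum_(l \in [set: int]) F l = \sum_(l \in A) F l.
Proof.
move=> h; symmetry; apply: fsbig_widen => // l [_ /= lA].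
by apply/eqP; apply: contra_notT lA => /h.
Qed.

Lemma has_fsumD V (F G : int -> V) u v :
  has_fsum F u -> has_fsum G v -> has_fsum (fun l => F l + G l) (u + v).
Proof.
(* The union of both supports is a finite index set over which all three sums may be taken. *)
move=> [fF <-] [fG <-]; set A := [set l | F l != 0] `|` [set l | G l != 0].
have fA : finite_set A by rewrite finite_setU.
have sub : [set l | F l + G l != 0] `<=` A.
  move=> l /= h; apply/orP; apply: contraNT h.
  by rewrite negb_or !negbK => /andP[/eqP-> /eqP->]; rewrite addr0.
split; first exact: sub_finite_set fA.
rewrite (has_fsumE sub) fsbig_split//.
by rewrite (@has_fsumE _ A F) 1?(@has_fsumE _ A G)// => l h; [right|left].
Qed.

(** A linear map fixes 0, so the support can only shrink, and on the finite support of [F]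
    additivity applies. *)
Lemma has_fsum_linear V W (f : V -> W) (F : int -> V) v : linear f ->
  has_fsum F v -> has_fsum (fun l => f (F l)) (f v).
Proof.
move=> fL [fF <-].
have sub : [set l | f (F l) != 0] `<=` [set l | F l != 0].
  by move=> l /=; apply: contra_neq => ->; exact: linear_0 fL.
split; first exact: sub_finite_set fF.
rewrite (has_fsumE sub) (@has_fsumE _ [set l | F l != 0] F)//.
rewrite !fsbig_finite//; symmetry; exact: (raddf_sum (linear_pack fL)).
Qed.

Lemma has_fsumN V (F : int -> V) v :
  has_fsum F v -> has_fsum (fun l => - F l) (- v).
Proof.
by apply: has_fsum_linear => c x y; rewrite opprD scalerN.
Qed.

Lemma has_fsumB V (F G : int -> V) u v :
  has_fsum F u -> has_fsum G v -> has_fsum (fun l => F l - G l) (u - v).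
Proof. by move=> Fu /has_fsumN; exact: has_fsumD. Qed.

Lemma has_fsum1 V (F : int -> V) m v :
  F m = v -> (forall l, l != m -> F l = 0) -> has_fsum F v.
Proof.
move=> <- Fm; have sub : [set l | F l != 0] `<=` [set m].
  by move=> l /=; apply: contra_neqP => /eqP/Fm.
split; first exact: sub_finite_set (finite_set1 m).
by rewrite (has_fsumE sub) fsbig_set1.
Qed.

Lemma eq_has_fsum V (F G : int -> V) v : F =1 G -> has_fsum G v -> has_fsum F v.
Proof. by move=> /funext->. Qed.

End FiniteSums.

(** * Additivity of iterated coproducts *)

Section Coproducts.
Variables (K : fieldType) (L : int -> lmodType K).

Lemma dsum_pure_ind (A : dsum L -> Prop) :
  (forall n (w : L n), A (dsum_in w)) -> (forall x y, A x -> A y -> A (x + y)) ->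
  forall x, A x.
Proof.
move=> Ain AD x; rewrite (dsum_decomp x); have [s [us sx]] := dsum_supp x.
rewrite (dsum_lift_seq (fun n => @dsum_in_linear _ _ n) us sx).
elim: s {us sx} => [|n s ih]; last by rewrite big_cons; apply: AD.
(* The empty sum is the homogeneous element 0, placed in degree 0. *)
by rewrite big_nil -(linear_0 (@dsum_in_linear _ L 0)).
Qed.

Variable d : {linear dsum L -> ctensor L L}.

Lemma coproduct_in_linear j k l : linear (fun v : L l => d (dsum_in v) j k).
Proof. by move=> c v w; rewrite dsum_in_linear linearP. Qed.

Arguments coproduct_in_linear : clear implicits.

Lemma ctermrD x y i j k l :
  ctermr d (d (x + y)) i j k l = ctermr d (d x) i j k l + ctermr d (d y) i j k l.
Proof.
have -> : d (x + y) = d x + d y by exact: linearD.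
exact: (linear_D (tmapr_linear (U := L i) (coproduct_in_linear j k l))).
Qed.

Lemma ctermlD x y i j k l :
  cterml d (d (x + y)) i j k l = cterml d (d x) i j k l + cterml d (d y) i j k l.
Proof.
have -> : d (x + y) = d x + d y by exact: linearD.
exact: (linear_D (tmapl_linear (V := L k) (coproduct_in_linear i j l))).
Qed.

Lemma has_fsum_ctermr x i j k : composable d ->
  has_fsum (ctermr d (d x) i j k) (cmapr d (d x) i j k).
Proof. by move=> /(_ x i j k)[? _]. Qed.

Lemma has_fsum_cterml x i j k : composable d ->
  has_fsum (cterml d (d x) i j k) (cmapl d (d x) i j k).
Proof. by move=> /(_ x i j k)[_ ?]. Qed.

(** The terms are always additive; the sums are so because composability makes them finite, the
    default value of an infinite sum not being additive. *)
Lemma cmaprD x y : composable d ->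
  cmapr d (d (x + y)) = cmapr d (d x) + cmapr d (d y).
Proof.
move=> dc; apply: dprodP => i; apply: dprodP => j; apply: dprodP => k.
have := has_fsumD (has_fsum_ctermr x i j k dc) (has_fsum_ctermr y i j k dc).
by case=> _ e; apply: etrans e; apply: eq_fsbigr => l _; exact: ctermrD.
Qed.

Lemma cmaplD x y : composable d ->
  cmapl d (d (x + y)) = cmapl d (d x) + cmapl d (d y).
Proof.
move=> dc; apply: dprodP => i; apply: dprodP => j; apply: dprodP => k.
have := has_fsumD (has_fsum_cterml x i j k dc) (has_fsum_cterml y i j k dc).
by case=> _ e; apply: etrans e; apply: eq_fsbigr => l _; exact: ctermlD.
Qed.

Lemma cswap12D (U V W : int -> lmodType K) :
  {morph @cswap12 K U V W : x y / x + y}.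
Proof.
move=> x y; apply: dprodP => i; apply: dprodP => j; apply: dprodP => k.
exact: tswap12D.
Qed.

(** The condition of [composable] at a single element, stable under sums and hence provable by
    induction over generators. *)
Definition composable_at (x : dsum L) := forall i j k,
  finite_set [set l | ctermr d (d x) i j k l != 0] /\
  finite_set [set l | cterml d (d x) i j k l != 0].

Lemma composable_atD x y :
  composable_at x -> composable_at y -> composable_at (x + y).
Proof.
move=> hx hy i j k; have [rx lx] := hx i j k; have [ry ly] := hy i j k.
have [fr _] := has_fsumD (has_fsum_finite rx) (has_fsum_finite ry).
have [fl _] := has_fsumD (has_fsum_finite lx) (has_fsum_finite ly).
split; [move: fr|move: fl]; congr (finite_set _); apply/seteqP; split=> l /=;
  by rewrite (ctermrD, ctermlD).
Qed.

End Coproducts.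
Arguments coproduct_in_linear {K L}.

(** * Terms of the iterated coproducts of the tensor product *)

Section TensorCoproductTerms.
Variables (K : fieldType) (P : lmodType K) (Q : int -> lmodType K).
Variables (br bl : {linear P -> tensor P P}).
Variable theta : {linear dsum Q -> ctensor Q Q}.
Let delta : {linear _ -> _} := tensor_coproduct br bl theta.

Lemma dsum_in_pure (a : P) n (v : Q n) :
  @dsum_in _ (gtensor P Q) n (a \ox v) = gpure a (dsum_in v).
Proof.
apply: dsumP => m; rewrite /gpure /=; have [<-|nm] := eqVneq n m.
  by rewrite /dsum_in_val !dfwithin.
by rewrite /dsum_in_val !dfwithout// pure0r.
Qed.

Lemma gtensor_pure_ind (A : dsum (gtensor P Q) -> Prop) :
  (forall a x, A (gpure a x)) -> (forall x y, A x -> A y -> A (x + y)) ->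
  forall x, A x.
Proof.
move=> Apure AD; apply: dsum_pure_ind => // n w.
elim/tensor_pure_ind: w => [a v|w w' hw hw']; last first.
  by rewrite (linear_D (@dsum_in_linear _ (gtensor P Q) n)); exact: AD.
by rewrite dsum_in_pure.
Qed.

Lemma tensor_coproduct_in (a : P) n (v : Q n) j k :
  delta (@dsum_in _ (gtensor P Q) n (a \ox v)) j k =
  tbullet (br a) (theta (dsum_in v) j k) -
  tbullet (tswap (bl a)) (tswap (theta (dsum_in v) k j)).
Proof. by rewrite dsum_in_pure [delta _]tensor_coproductE. Qed.

Let tswap_bl_linear : linear (fun b => tswap (bl b)).
Proof. by move=> c b b'; rewrite linearP tswap_linear. Qed.

Let tswap_theta_linear j k l :
  linear (fun v : Q l => tswap (theta (dsum_in v) j k)).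
Proof.
by move=> c v w; rewrite (coproduct_in_linear theta) tswap_linear.
Qed.

Arguments tswap_theta_linear : clear implicits.

(** Each of the two summands of [delta] is followed by each of the two. All flips are pulled out as
    permutations, and a flip before a right map turns it into a left map, whence the [tmapl] and
    [cterml]. The degrees of the [theta] terms are permuted accordingly. *)
Lemma ctermr_coproduct a x i j k l :
  ctermr delta (delta (gpure a x)) i j k l =
    bullet3 (tmapr br (br a)) (ctermr theta (theta x) i j k l)
  - bullet3 (tswap12 (trot (tmapr bl (br a))))
      (tswap12 (trot (ctermr theta (theta x) i k j l)))
  - (bullet3 (trot (tmapl br (bl a))) (trot (cterml theta (theta x) j k i l))
     - bullet3 (tswap12 (trot (trot (tmapl bl (bl a)))))
      (tswap12 (trot (trot (cterml theta (theta x) k j i l))))).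
Proof.
rewrite /ctermr /cterml [delta (gpure a x)]tensor_coproductE.
have brL : linear br by exact: linearP.
have blL : linear bl by exact: linearP.
rewrite (linear_B (tmapr_linear (coproduct_in_linear delta j k _))).
rewrite !(tmapr_bullet (coproduct_in_linear delta j k l) brL tswap_bl_linear
  (coproduct_in_linear theta j k l) (tswap_theta_linear k j l)
  (fun a v => tensor_coproduct_in a v j k)).
rewrite !tmapr_tswap//; [|exact: coproduct_in_linear..].
by rewrite !tmapr_swap//; exact: coproduct_in_linear.
Qed.

Lemma cterml_coproduct a x i j k l :
  cterml delta (delta (gpure a x)) i j k l =
    bullet3 (tmapl br (br a)) (cterml theta (theta x) i j k l)
  - bullet3 (tswap12 (tmapl bl (br a))) (tswap12 (cterml theta (theta x) j i k l))
  - (bullet3 (trot (trot (tmapr br (bl a))))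
      (trot (trot (ctermr theta (theta x) k i j l)))
     - bullet3 (tswap12 (trot (trot (tmapr bl (bl a)))))
      (tswap12 (trot (trot (ctermr theta (theta x) k j i l))))).
Proof.
rewrite /ctermr /cterml [delta (gpure a x)]tensor_coproductE.
have brL : linear br by exact: linearP.
have blL : linear bl by exact: linearP.
rewrite (linear_B (tmapl_linear (coproduct_in_linear delta i j _))).
rewrite !(tmapl_bullet (coproduct_in_linear delta i j l) brL tswap_bl_linear
  (coproduct_in_linear theta i j l) (tswap_theta_linear j i l)
  (fun a v => tensor_coproduct_in a v i j)).
rewrite !tmapl_tswap//; [|exact: coproduct_in_linear..].
by rewrite !tmapl_swap//; exact: coproduct_in_linear.
Qed.

End TensorCoproductTerms.

(** * The pre-Lie identity *)

Lemma subrACA (V : zmodType) (x y z t : V) : x - y - (z - t) = x - z - (y - t).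
Proof. by rewrite [in LHS]opprD addrACA -opprD. Qed.

Section MapAdd.
Variables (K : fieldType) (U V X Y : lmodType K).

Lemma tmaplDf (f g : U -> tensor X Y) (x : tensor U V) :
  tmapl (fun u => f u + g u) x = tmapl f x + tmapl g x.
Proof.
rewrite -[tmapl f x]scale1r; apply: tlift_comb => u v.
by rewrite scale1r pureDl.
Qed.

Lemma tmaprDf (f g : V -> tensor X Y) (x : tensor U V) :
  tmapr (fun v => f v + g v) x = tmapr f x + tmapr g x.
Proof.
rewrite /tmapr -tassocD; congr tassoc; rewrite -[tmap _ f x]scale1r.
by apply: tlift_comb => u v; rewrite scale1r pureDr.
Qed.
End MapAdd.

(** * The Zinbiel-dendriform identities as three equations *)

Section Zinbiel.
Variables (K : fieldType) (P : lmodType K) (br bl : {linear P -> tensor P P}).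

(** The last member of the first chain of coalgebra identities, with the flips pulled out as
    [tswap12]. *)
Definition zd_sum (a : P) :=
  tmapl br (br a) + tswap12 (tmapl br (br a))
  + (tmapl bl (br a) + tswap12 (tmapl bl (br a))).

(** The image of [tmapl bl (bl a) + tswap12 (tmapl br (bl a))], a member of the second chain of
    identities, under two rotations followed by [tswap12]. *)
Definition zd_left (a : P) :=
  trot (tmapl br (bl a)) + tswap12 (trot (trot (tmapl bl (bl a)))).

Definition zd_right (a : P) := tmapr br (bl a) + tmapr bl (bl a).

(** [tswap12] exchanges the summands in pairs. The symmetry of [tmapr br (br a)] is obtained from
    this once that element equals [zd_sum]. *)
Lemma zd_sum_sym a : tswap12 (zd_sum a) = zd_sum a.
Proof.
rewrite /zd_sum !tswap12D !tswap12K [X in X + _]addrC; congr (_ + _).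
exact: addrC.
Qed.

(* These are the equations found by comparing coefficients in the pre-Lie identity. *)
Lemma zinbiel_dendriformP :
  zinbiel_dendriform_coalgebra br bl <-> forall a,
  [/\ tmapr br (br a) = zd_sum a,
      trot (tmapr bl (br a)) = zd_left a &
      trot (trot (zd_right a)) = tswap12 (zd_left a)].
Proof.
have brL : linear br by exact: linearP.
have blL : linear bl by exact: linearP.
have sumE a :
    tmapl (fun b => br b + tswap (br b) + bl b + tswap (bl b)) (br a) = zd_sum a.
  by rewrite !tmaplDf !tmapl_tswap// /zd_sum !addrA.
have rightE a : tmapr (fun b => br b + bl b) (bl a) = zd_right a.
  by rewrite tmaprDf.
have rot_swap (x : tensor (tensor P P) P) :
    trot (trot (tswap12 x)) = tswap12 (trot x).
  by rewrite trot_swap12 trot_swap12 trotK.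
split=> h a; have := h a; rewrite sumE rightE.
- case=> _ -> e1 e2; rewrite e1; split=> //.
    (* Under [tswap12] the left side becomes two rotations of [tswap12 (tmapr bl (br a))], which
       [e2] and [e1] express through the members of the second chain. *)
    apply: tswap12_inj; rewrite -rot_swap -e2 e1 /zd_left.
    by rewrite !trotD tswap12D rot_swap tswap12K addrC.
  rewrite /zd_left trotD trotD rot_swap tswap12D tswap12K.
  by rewrite addrC.
- case=> eA eA' eN.
  (* [zd_left] is eliminated between the last two equations and two rotations are cancelled. *)
  have rN : zd_right a = tswap12 (tmapr bl (br a)).
    by do 2!apply: trot_inj; rewrite eN -eA' rot_swap.
  split; rewrite ?rN ?eA ?zd_sum_sym//.
  do 2!apply: trot_inj; rewrite rot_swap eA' /zd_left tswap12D tswap12K.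
  by rewrite !trotD rot_swap addrC.
Qed.
End Zinbiel.

(** * Both sides of the pre-Lie identity on the tensor product *)

Section PreLie.
Variables (K : fieldType) (P : lmodType K) (Q : int -> lmodType K).
Variables (br bl : {linear P -> tensor P P}).
Variable theta : {linear dsum Q -> ctensor Q Q}.
Let delta : {linear _ -> _} := tensor_coproduct br bl theta.

Hypothesis theta_composable : composable theta.
Hypothesis theta_leibniz : forall x, cmapr theta (theta x) =
  cmapl theta (theta x) + cswap12 (cmapr theta (theta x)).

Section Pure.
Variables (a : P) (x : dsum Q).
Let R := cmapr theta (theta x).
Let L := cmapl theta (theta x).

(** The Leibniz identity solved for [L], by which everything is expressed through [R]. *)
Let LE i j k : L i j k = R i j k - tswap12 (R j i k).
Proof.
have e : R i j k = L i j k + tswap12 (R j i k).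
  by rewrite -[RHS]/((L + cswap12 R) i j k) /L /R -theta_leibniz.
by rewrite {1}e addrK.
Qed.

(** [L] is skew in its first two factors, being the difference of [R] and its swap. This is what
    merges terms in pairs below. *)
Let swapL i j k : tswap12 (L j i k) = - L i j k.
Proof. by rewrite !LE tswap12B tswap12K opprB. Qed.

Lemma has_fsum_ctermr_coproduct i j k :
  has_fsum (ctermr delta (delta (gpure a x)) i j k)
  ( bullet3 (tmapr br (br a)) (R i j k)
  - bullet3 (tswap12 (trot (tmapr bl (br a)))) (tswap12 (trot (R i k j)))
  - (bullet3 (trot (tmapl br (bl a))) (trot (L j k i))
     - bullet3 (tswap12 (trot (trot (tmapl bl (bl a)))))
      (tswap12 (trot (trot (L k j i)))))).
Proof.
apply: eq_has_fsum (ctermr_coproduct _ _ _ _ _ _ _ _) _.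
apply: has_fsumB; apply: has_fsumB.
- exact: has_fsum_linear (bullet3_linearr _) (has_fsum_ctermr _ _ _ _ _).
- apply: has_fsum_linear (bullet3_linearr _) _.
  apply: has_fsum_linear (@tswap12_linear _ _ _ _) _.
  apply: has_fsum_linear (@trot_linear _ _ _ _) _.
  exact: has_fsum_ctermr.
- apply: has_fsum_linear (bullet3_linearr _) _.
  apply: has_fsum_linear (@trot_linear _ _ _ _) _.
  exact: has_fsum_cterml.
- apply: has_fsum_linear (bullet3_linearr _) _.
  apply: has_fsum_linear (@tswap12_linear _ _ _ _) _.
  do 2!apply: has_fsum_linear (@trot_linear _ _ _ _) _.
  exact: has_fsum_cterml.
Qed.

Lemma has_fsum_cterml_coproduct i j k :
  has_fsum (cterml delta (delta (gpure a x)) i j k)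
  ( bullet3 (tmapl br (br a)) (L i j k)
  - bullet3 (tswap12 (tmapl bl (br a))) (tswap12 (L j i k))
  - (bullet3 (trot (trot (tmapr br (bl a)))) (trot (trot (R k i j)))
     - bullet3 (tswap12 (trot (trot (tmapr bl (bl a)))))
      (tswap12 (trot (trot (R k j i)))))).
Proof.
apply: eq_has_fsum (cterml_coproduct _ _ _ _ _ _ _ _) _.
apply: has_fsumB; apply: has_fsumB.
- exact: has_fsum_linear (bullet3_linearr _) (has_fsum_cterml _ _ _ _ _).
- apply: has_fsum_linear (bullet3_linearr _) _.
  apply: has_fsum_linear (@tswap12_linear _ _ _ _) _.
  exact: has_fsum_cterml.
- apply: has_fsum_linear (bullet3_linearr _) _.
  do 2!apply: has_fsum_linear (@trot_linear _ _ _ _) _.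
  exact: has_fsum_ctermr.
- apply: has_fsum_linear (bullet3_linearr _) _.
  apply: has_fsum_linear (@tswap12_linear _ _ _ _) _.
  do 2!apply: has_fsum_linear (@trot_linear _ _ _ _) _.
  exact: has_fsum_ctermr.
Qed.

Let swap_rot2 (X Y Z : lmodType K) (z : tensor (tensor X Y) Z) :
  tswap12 (trot (trot z)) = trot (tswap12 z).
Proof. by rewrite trot_swap12. Qed.

(** By skewness both [L] terms become bullets with the same [trot (L j k i)]; their coefficients add
    up to [zd_left]. *)
Lemma cmapr_coproduct i j k : cmapr delta (delta (gpure a x)) i j k =
  bullet3 (tmapr br (br a)) (R i j k)
  - bullet3 (tswap12 (trot (tmapr bl (br a)))) (tswap12 (trot (R i k j)))
  - bullet3 (zd_left br bl a) (trot (R j k i) - tswap12 (trot (trot (R k j i)))).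
Proof.
have [_ e] := has_fsum_ctermr_coproduct i j k; apply: etrans e _.
congr (_ - _); rewrite (swap_rot2 (L k j i)) swapL trotN bullet3Nr opprK -bullet3Dl.
by rewrite LE trotB -(swap_rot2 (R k j i)).
Qed.

Lemma cmapl_coproduct i j k : cmapl delta (delta (gpure a x)) i j k =
  bullet3 (tmapl br (br a) + tswap12 (tmapl bl (br a))) (R i j k - tswap12 (R j i k))
  - (bullet3 (trot (trot (tmapr br (bl a)))) (trot (trot (R k i j)))
     - bullet3 (tswap12 (trot (trot (tmapr bl (bl a)))))
      (tswap12 (trot (trot (R k j i))))).
Proof.
have [_ e] := has_fsum_cterml_coproduct i j k; apply: etrans e _.
by congr (_ - _); rewrite swapL bullet3Nr opprK -bullet3Dl LE.
Qed.

(** The left side of the pre-Lie identity as a combination of the six permutations of [R]. *)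
Lemma cmapr_coproduct_skew i j k :
  cmapr delta (delta (gpure a x)) i j k -
    tswap12 (cmapr delta (delta (gpure a x)) j i k) =
  (bullet3 (tmapr br (br a)) (R i j k)
   - bullet3 (tswap12 (tmapr br (br a))) (tswap12 (R j i k)))
  + (bullet3 (trot (tmapr bl (br a))) (trot (R j k i))
   - bullet3 (tswap12 (trot (tmapr bl (br a)))) (tswap12 (trot (R i k j))))
  - (bullet3 (zd_left br bl a) (trot (R j k i) - tswap12 (trot (trot (R k j i))))
   - bullet3 (tswap12 (zd_left br bl a))
      (tswap12 (trot (R i k j)) - trot (trot (R k i j)))).
Proof.
rewrite !cmapr_coproduct !tswap12B !tswap12_bullet3 !tswap12B !tswap12K.
by rewrite subrACA; congr (_ - _); rewrite subrACA opprB.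
Qed.

(** The right side, in the same form. Each coefficient is collected from the composite and its swap,
    which is how [zd_sum] and [zd_right] arise. *)
Lemma cmapl_coproduct_skew i j k :
  cmapl delta (delta (gpure a x)) i j k -
    tswap12 (cmapl delta (delta (gpure a x)) j i k) =
  bullet3 (zd_sum br bl a) (R i j k - tswap12 (R j i k))
  + (bullet3 (tswap12 (trot (trot (zd_right br bl a)))) (tswap12 (trot (trot (R k j i))))
   - bullet3 (trot (trot (zd_right br bl a))) (trot (trot (R k i j)))).
Proof.
rewrite !cmapl_coproduct !tswap12B !tswap12_bullet3 !(tswap12B, tswap12D) !tswap12K.
rewrite subrACA -[tswap12 (R j i k) - _]opprB bullet3Nr opprK -bullet3Dl.
congr (_ + _).
  by rewrite addrACA [tswap12 (tmapl bl _) + _]addrC.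
by rewrite opprB subrACA opprB addrACA -opprD -!bullet3Dl !(trotD, tswap12D).
Qed.
End Pure.

Lemma prelie_coproduct :
  zinbiel_dendriform_coalgebra br bl -> completed_prelie_coalgebra delta.
Proof.
move=> /zinbiel_dendriformP zd.
have dc : composable delta.
  (* The finiteness on generators comes with the sums already computed, and it is stable under
     addition. *)
  suff h x : composable_at delta x by move=> x i j k; exact: h.
  elim/gtensor_pure_ind: x => [a x|x y]; last exact: composable_atD.
  move=> i j k; split.
    by have [] := has_fsum_ctermr_coproduct a x i j k.
  by have [] := has_fsum_cterml_coproduct a x i j k.
split=> // x; elim/gtensor_pure_ind: x => [a x|x y hx hy]; last first.
  rewrite (cmaprD x y dc) (cmaplD x y dc) !cswap12D !opprD.
  by rewrite [LHS]addrACA [RHS]addrACA; congr (_ + _).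
apply: dprodP => i; apply: dprodP => j; apply: dprodP => k.
apply: etrans (cmapr_coproduct_skew a x i j k) _.
apply: etrans (esym (cmapl_coproduct_skew a x i j k)).
have [-> -> ->] := zd a.
rewrite zd_sum_sym tswap12K -bullet3Br -addrA; congr (_ + _).
(* The bullets with [trot R] and [tswap12 (trot R)] cancel on the left, leaving those with two
   rotations, as on the right. *)
by rewrite subrACA !bullet3Br !subKr.
Qed.

End PreLie.

(** * Contraction with linear functionals *)

Section Contraction.
Variable K : fieldType.
Implicit Types P X Y Z : lmodType K.

Definition contract P X (f : X -> K) : tensor P X -> P :=
  tlift (fun a x => f x *: a).

(** The functional [f \ox g \ox h]; the target [K^o] is the field viewed as a module over itself. *)
Definition eval3 X Y Z (f : X -> K) (g : Y -> K) (h : Z -> K) :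
    tensor (tensor X Y) Z -> K^o :=
  tlift (fun u z => tlift (fun x y => f x * g y : K^o) u * h z : K^o).

Section ContractLinear.
Variables (P X : lmodType K) (f : X -> K^o).
Hypothesis fL : linear f.

Let body_l x : linear (fun a : P => f x *: a).
Proof. by move=> c a b; rewrite scalerDr !scalerA mulrC. Qed.

Let body_r (a : P) : linear (fun x => f x *: a).
Proof. by move=> c x y; rewrite fL scalerDl scalerA. Qed.

Lemma contract_linear : linear (contract (P := P) f).
Proof. exact: tlift_linear. Qed.

Lemma contract_pure (a : P) x : contract f (a \ox x) = f x *: a.
Proof. exact: tlift_pure. Qed.
End ContractLinear.

Section Eval.
Variables (X Y Z : lmodType K) (f : X -> K^o) (g : Y -> K^o) (h : Z -> K^o).
Hypotheses (fL : linear f) (gL : linear g) (hL : linear h).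

Let body_l y : linear (fun x => f x * g y : K^o).
Proof. by move=> c x x'; rewrite fL mulrDl -mulrA. Qed.

Let body_r x : linear (fun y => f x * g y : K^o).
Proof. by move=> c y y'; rewrite gL mulrDr mulrCA. Qed.

Let inner_linear : linear (tlift (fun x y => f x * g y : K^o)).
Proof. exact: tlift_linear. Qed.

Let outer_l z :
  linear (fun u => tlift (fun x y => f x * g y : K^o) u * h z : K^o).
Proof. by move=> c u u'; rewrite inner_linear mulrDl -mulrA. Qed.

Let outer_r u :
  linear (fun z => tlift (fun x y => f x * g y : K^o) u * h z : K^o).
Proof. by move=> c z z'; rewrite hL mulrDr mulrCA. Qed.

Lemma eval3_linear : linear (eval3 f g h).
Proof. exact: tlift_linear. Qed.

Lemma eval3_pure x y z : eval3 f g h ((x \ox y) \ox z) = f x * g y * h z.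
Proof. by rewrite /eval3 tlift_pure// tlift_pure. Qed.

(** Contracting the second components separates the two arguments of the bullet: only [s] is left,
    scaled by an evaluation of [t]. This is how coefficients are read off. *)
Lemma contract_bullet3 P (s : tensor (tensor P P) P) (t : tensor (tensor X Y) Z) :
  tmap (tmap (contract f) (contract g)) (contract h) (bullet3 s t) =
  (eval3 f g h t : K) *: s.
Proof.
have fcL := contract_linear (P := P) fL; have gcL := contract_linear (P := P) gL.
have hcL := contract_linear (P := P) hL; have fgL := tmap_linear fcL gcL.
have cD := linear_D (tmap_linear fgL hcL).
elim/tensor3_pure_ind: s => [a b c|s s' hs hs']; last first.
  by rewrite bullet3Dl cD hs hs' scalerDr.
elim/tensor3_pure_ind: t => [x y z|t t' ht ht']; last first.
  by rewrite bullet3Dr cD ht ht' (linear_D eval3_linear) scalerDl.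
rewrite bullet3_pure !tmap_pure// !contract_pure// eval3_pure.
by rewrite !(pureZl, pureZr) !scalerA [_ * h z]mulrC mulrA.
Qed.
End Eval.

Section EvalPerm.
Variables (X Y Z : lmodType K) (f : X -> K^o) (g : Y -> K^o) (h : Z -> K^o).
Hypotheses (fL : linear f) (gL : linear g) (hL : linear h).

(** Permuting the tensor amounts to permuting the functionals, so all permutations of [R] yield
    evaluations of one tensor. *)
Lemma eval3_swap12 (t : tensor (tensor Y X) Z) :
  eval3 f g h (tswap12 t) = eval3 g f h t.
Proof.
elim/tensor3_pure_ind: t => [x y z|t t' ht ht'].
  by rewrite !tpermE !eval3_pure// [f _ * _]mulrC.
by rewrite tswap12D !(linear_D (eval3_linear _ _ _))// ht ht'.
Qed.

Lemma eval3_rot (t : tensor (tensor Y Z) X) :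
  eval3 f g h (trot t) = eval3 g h f t.
Proof.
elim/tensor3_pure_ind: t => [x y z|t t' ht ht'].
  by rewrite !tpermE !eval3_pure// -mulrA mulrC.
by rewrite trotD !(linear_D (eval3_linear _ _ _))// ht ht'.
Qed.
End EvalPerm.
End Contraction.

(** * The Laurent coalgebra *)

Lemma tmap_0r (K : fieldType) (U V X Y : lmodType K) (f : U -> X) (t : tensor U V) :
  tmap f (fun=> 0 : Y) t = 0.
Proof. by rewrite /tmap /tlift big1// => p _; exact: pure0r. Qed.

Lemma tmap_0l (K : fieldType) (U V X Y : lmodType K) (g : V -> Y) (t : tensor U V) :
  tmap (fun=> 0 : X) g t = 0.
Proof.
rewrite /tmap /tlift big1// => p _; exact: (linear_0 (pure_linearl _)).
Qed.

Section Laurent.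
Variables (K : fieldType) (W : vectType K).
Variable theta : {linear dsum (fun n => laurent W n) ->
                         ctensor (fun n => laurent W n) (fun n => laurent W n)}.
Variable w : W -> tensor W W.
Hypothesis wL : linear w.
Hypothesis thetaE : forall v n, theta (monomial v n) = antidiagonal (w v) n.

Let theta_inE j k l : (fun u : laurent W l => theta (dsum_in u) j k) =
  if j + k == l then w else fun=> 0.
Proof.
apply/funext => u; rewrite -[dsum_in u]/(monomial u l) thetaE /antidiagonal.
by case: ifP.
Qed.

Lemma ctermr_laurent v n i j k l :
  ctermr theta (theta (monomial v n)) i j k l =
  if (i + l == n) && (j + k == l) then tmapr w (w v) else 0.
Proof.
rewrite /ctermr theta_inE thetaE /antidiagonal.
case: (i + l == n) => /=; last first.
  case: ifP => _; first exact: (linear_0 (tmapr_linear wL)).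
  by rewrite /tmapr tmap_0r (linear_0 (@tassoc_linear _ _ _ _)).
case: (j + k == l) => //.
by rewrite /tmapr tmap_0r (linear_0 (@tassoc_linear _ _ _ _)).
Qed.

Lemma cterml_laurent v n i j k l :
  cterml theta (theta (monomial v n)) i j k l =
  if (l + k == n) && (i + j == l) then tmapl w (w v) else 0.
Proof.
rewrite /cterml theta_inE thetaE /antidiagonal.
case: (l + k == n) => /=; last first.
  by case: ifP => _; [exact: (linear_0 (tmapl_linear wL))|exact: tmap_0l].
by case: (i + j == l) => //; exact: tmap_0l.
Qed.

Let has_fsum_r v n i j k :
  has_fsum (ctermr theta (theta (monomial v n)) i j k)
    (if i + j + k == n then tmapr w (w v) else 0).
Proof.
(* The inner degree [l] is forced by [i + l = n]; the term survives exactly when also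
   [j + k = n - i]. *)
apply: (has_fsum1 (m := n - i)) => [|l ln]; rewrite ctermr_laurent.
  rewrite [i + (n - i)]addrC subrK eqxx /= [j + k == _]eq_sym subr_eq eq_sym.
  by rewrite addrC addrA.
case: eqP => //= il; by move: ln; rewrite -il [i + l]addrC addrK eqxx.
Qed.

Let has_fsum_l v n i j k :
  has_fsum (cterml theta (theta (monomial v n)) i j k)
    (if i + j + k == n then tmapl w (w v) else 0).
Proof.
apply: (has_fsum1 (m := n - k)) => [|l ln]; rewrite cterml_laurent.
  by rewrite subrK eqxx /= [i + j == _]eq_sym subr_eq eq_sym.
case: eqP => //= il; by move: ln; rewrite -il addrK eqxx.
Qed.

Lemma laurent_composable : composable theta.
Proof.
suff h x : composable_at theta x by move=> x i j k; exact: h.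
elim/dsum_pure_ind: x => [n v|x y]; last exact: composable_atD.
move=> i j k; split; first by have [] := has_fsum_r v n i j k.
by have [] := has_fsum_l v n i j k.
Qed.

Lemma cmapr_laurent v n i j k :
  cmapr theta (theta (monomial v n)) i j k =
  if i + j + k == n then tmapr w (w v) else 0.
Proof. by have [] := has_fsum_r v n i j k. Qed.

Lemma cmapl_laurent v n i j k :
  cmapl theta (theta (monomial v n)) i j k =
  if i + j + k == n then tmapl w (w v) else 0.
Proof. by have [] := has_fsum_l v n i j k. Qed.

Hypothesis w_leibniz :
  forall v, tmapr w (w v) = tmapl w (w v) + tswap12 (tmapr w (w v)).

(** Both composites live in the degrees with [i + j + k = n] and repeat there one tensor over [W],
    so the identity reduces to the one for [w]. *)
Lemma laurent_leibniz : completed_leibniz_coalgebra theta.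
Proof.
have tc := laurent_composable; split=> // x.
elim/dsum_pure_ind: x => [n v|x y hx hy]; last first.
  rewrite (cmaprD x y tc) (cmaplD x y tc) cswap12D.
  by rewrite [RHS]addrACA; congr (_ + _).
apply: dprodP => i; apply: dprodP => j; apply: dprodP => k.
apply: etrans (cmapr_laurent _ _ _ _ _) _.
transitivity (cmapl theta (theta (monomial v n)) i j k
  + tswap12 (cmapr theta (theta (monomial v n)) j i k)) => //.
rewrite cmapl_laurent cmapr_laurent [j + i]addrC; case: ifP => _ /=.
  exact: w_leibniz.
by rewrite (linear_0 (@tswap12_linear _ _ _ _)) addr0.
Qed.

Section Converse.
Variables (P : lmodType K) (br bl : {linear P -> tensor P P}).
Hypothesis prelie : completed_prelie_coalgebra (tensor_coproduct br bl theta).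

(** The pre-Lie identity at [a \ox v t^0], read in degree (0, 0, 0) and contracted with [f], [g],
    [h]. *)
Lemma prelie_coefficients a v r (f g h : W -> K^o) :
  tmapr w (w v) = r -> linear f -> linear g -> linear h ->
  (eval3 f g h r : K) *: tmapr br (br a) -
    (eval3 g f h r : K) *: tswap12 (tmapr br (br a))
  + ((eval3 g h f r : K) *: trot (tmapr bl (br a)) -
    (eval3 f h g r : K) *: tswap12 (trot (tmapr bl (br a))))
  - (((eval3 g h f r : K) - (eval3 h g f r : K)) *: zd_left br bl a -
     ((eval3 f h g r : K) - (eval3 h f g r : K)) *: tswap12 (zd_left br bl a)) =
  ((eval3 f g h r : K) - (eval3 g f h r : K)) *: zd_sum br bl a
  + ((eval3 h g f r : K) *: tswap12 (trot (trot (zd_right br bl a))) -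
     (eval3 h f g r : K) *: trot (trot (zd_right br bl a))).
Proof.
move=> rE fL gL hL.
have [tc tl] := laurent_leibniz.
have R0 : cmapr theta (theta (monomial v 0)) 0 0 0 = r by rewrite cmapr_laurent.
have [_ /(_ (gpure a (monomial v 0)))/(congr1 (fun z => z 0 0 0)) e] := prelie.
have {e} := etrans (esym (cmapr_coproduct_skew br bl tc tl a (monomial v 0) 0 0 0))
  (etrans e (cmapl_coproduct_skew br bl tc tl a (monomial v 0) 0 0 0)).
rewrite R0.
(* The contraction is kept abstract, known only by its linearity and its effect on bullets. *)
have [C [CL CE]] : exists C : tensor (tensor (tensor P W) (tensor P W)) (tensor P W) ->
    tensor (tensor P P) P,
    linear C /\ forall s t, C (bullet3 s t) = (eval3 f g h t : K) *: s.
  have fgL := tmap_linear (contract_linear (P := P) fL) (contract_linear (P := P) gL).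
  exists (tmap (tmap (contract f) (contract g)) (contract h)); split.
    exact: tmap_linear fgL (contract_linear hL).
  exact: contract_bullet3.
move/(congr1 C); rewrite !(linear_B CL, linear_D CL) !CE.
rewrite !(linear_B (eval3_linear fL gL hL)).
by rewrite !(eval3_swap12, eval3_rot).
Qed.

End Converse.

End Laurent.

(** * The four-dimensional Leibniz coalgebra *)

Section FourDim.
Variables (K : fieldType) (W : vectType K) (e1 e2 e3 e4 : W).
Variable theta : {linear dsum (fun n => laurent W n) ->
                         ctensor (fun n => laurent W n) (fun n => laurent W n)}.
Hypothesis eB : basis_of fullv [:: e1; e2; e3; e4].
Hypothesis theta1 : forall n, theta (monomial e1 n) =
  antidiagonal (e1 \ox e4 - e4 \ox e1) n.
Hypothesis theta2 : forall n, theta (monomial e2 n) =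
  antidiagonal (e1 \ox e3 + (e1 \ox e4) *+ 2 - e4 \ox e1) n.
Hypothesis theta3 : forall n, theta (monomial e3 n) =
  antidiagonal (e4 \ox e3 + e4 \ox e4) n.
Hypothesis theta4 : forall n, theta (monomial e4 n) = 0.

Lemma basis4_ind (A : W -> Prop) : A e1 -> A e2 -> A e3 -> A e4 ->
  (forall c u v, A u -> A v -> A (c *: u + v)) -> forall v, A v.
Proof.
move=> A1 A2 A3 A4 AL v.
(* Zero is reached as [-1 *: e1 + e1]. *)
have A0 : A 0 by have := AL (-1) _ _ A1 A1; rewrite scaleN1r addNr.
have -> := @coord_basis _ _ fullv 4 [tuple e1; e2; e3; e4] v eB (memvf v).
rewrite !big_ord_recl big_ord0 /=.
exact: AL _ _ _ A1 (AL _ _ _ A2 (AL _ _ _ A3 (AL _ _ _ A4 A0))).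
Qed.

(** The coproduct on [W] underlying [theta], recovered from degree (0, 0). *)
Definition coproduct0 (v : W) : tensor W W := theta (monomial v 0) 0 0.

Lemma coproduct0_linear : linear coproduct0.
Proof. exact: (coproduct_in_linear theta). Qed.

Lemma coproduct0_1 : coproduct0 e1 = e1 \ox e4 - e4 \ox e1.
Proof. by rewrite /coproduct0 theta1. Qed.
Lemma coproduct0_2 :
  coproduct0 e2 = e1 \ox e3 + (e1 \ox e4 + e1 \ox e4) - e4 \ox e1.
Proof. by rewrite /coproduct0 theta2 mulr2n. Qed.
Lemma coproduct0_3 : coproduct0 e3 = e4 \ox e3 + e4 \ox e4.
Proof. by rewrite /coproduct0 theta3. Qed.
Lemma coproduct0_4 : coproduct0 e4 = 0.
Proof. by rewrite /coproduct0 theta4. Qed.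

Lemma theta_monomial v n : theta (monomial v n) = antidiagonal (coproduct0 v) n.
Proof.
elim/basis4_ind: v => [||||c u v hu hv].
- by rewrite theta1 coproduct0_1.
- by rewrite theta2 coproduct0_2 mulr2n.
- by rewrite theta3 coproduct0_3.
- rewrite theta4 coproduct0_4; apply: dprodP => i; apply: dprodP => j.
  by rewrite /antidiagonal if_same.
- have -> : monomial (c *: u + v) n = c *: monomial u n + monomial v n.
    exact: (@dsum_in_linear _ (fun n => laurent W n)).
  rewrite linearP hu hv coproduct0_linear.
  apply: dprodP => i; apply: dprodP => j; rewrite /antidiagonal.
  transitivity (c *: (if i + j == n then coproduct0 u else 0)
    + (if i + j == n then coproduct0 v else 0)) => //.
  by case: ifP => // _; rewrite scaler0 addr0.
Qed.

Let r0 := linear_0 (tmapr_linear (U := W) coproduct0_linear).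
Let l0 := linear_0 (tmapl_linear (V := W) coproduct0_linear).
Let rD := linear_D (tmapr_linear (U := W) coproduct0_linear).
Let rN := linear_N (tmapr_linear (U := W) coproduct0_linear).
Let lD := linear_D (tmapl_linear (V := W) coproduct0_linear).
Let lN := linear_N (tmapl_linear (V := W) coproduct0_linear).
Let rE (u v : W) := tmapr_pure u v coproduct0_linear.
Let lE (u v : W) := tmapl_pure u v coproduct0_linear.
Let pure0l (u : W) := linear_0 (pure_linearl (U := tensor W W) u).
Let tassoc0 := linear_0 (@tassoc_linear K W W W).
Let tswap0 := linear_0 (@tswap12_linear K W W W).
Let coproduct0E := (coproduct0_1, coproduct0_2, coproduct0_3, coproduct0_4).
(** Rewriting rules that expand both composites of [coproduct0] on a basis vector into signed sums
    of pure tensors. *)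
Let expandE := (r0, l0, rD, rN, lD, lN, (rE, lE, coproduct0E),
  (pureDl, pureNl, pureDr, pureNr), (tassocN, tassocD, tassoc_pure),
  (@pure0r K W (tensor W W), pure0l, tassoc0, tswap0, oppr0, addr0, add0r),
  (tswap12N, tswap12D, tpermE)).

Lemma iterated_coproduct0_2 : tmapr coproduct0 (coproduct0 e2) =
  e1 \ox e4 \ox e3 + e1 \ox e4 \ox e4 - (e4 \ox e1 \ox e4 - e4 \ox e4 \ox e1).
Proof. by rewrite !expandE. Qed.

Lemma coproduct0_leibniz v :
  tmapr coproduct0 (coproduct0 v) =
  tmapl coproduct0 (coproduct0 v) + tswap12 (tmapr coproduct0 (coproduct0 v)).
Proof.
elim/basis4_ind: v => [||||c u v hu hv].
- by rewrite !expandE subrACA subrr sub0r.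
- rewrite !expandE; set a := e1 \ox e4 \ox e3; set b := e1 \ox e4 \ox e4.
  set c := e4 \ox e1 \ox e4; set d := e4 \ox e4 \ox e1.
  (* The terms are grouped by [b - c], which the left composite contributes twice and the swapped
     one once with a minus sign; the terms [e4 \ox e1 \ox e3] cancel. *)
  have -> : a + b - (c - d) = a + (d + (b - c)) 
    by rewrite -addrA; congr (_ + _); rewrite opprB addrCA.
  rewrite -[_ + c - _]addrA; have -> : c - (b - d) = d - (b - c).
    by rewrite !opprB addrCA.
  rewrite [RHS]addrACA subrK; congr (_ + _).
  by rewrite addrACA subrr addr0 addrC.
- by rewrite !expandE.
- by rewrite !expandE.
- have rL := tmapr_linear (U := W) coproduct0_linear.
  have lL := tmapl_linear (V := W) coproduct0_linear.
  rewrite !coproduct0_linear rL lL tswap12_linear {1}hu {1}hv scalerDr.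
  exact: addrACA.
Qed.

Lemma prelie_zinbiel (P : lmodType K) (br bl : {linear P -> tensor P P}) :
  completed_prelie_coalgebra (tensor_coproduct br bl theta) ->
  zinbiel_dendriform_coalgebra br bl.
Proof.
move=> prelie; apply/zinbiel_dendriformP => a.
have freeX : free [tuple e1; e2; e3; e4] := basis_free eB.
pose f (i : 'I_4) : W -> K^o := coord [tuple e1; e2; e3; e4] i.
have fL i : linear (f i) by move=> c u v; rewrite /f linearP.
have fE i (j : 'I_4) : f i [:: e1; e2; e3; e4]`_j = (j == i)%:R.
  exact: (coord_free j i freeX).
(* Indices into the basis start at 0, so [e1], [e3], [e4] have positions 0, 2, 3. *)
pose i1 : 'I_4 := @Ordinal 4 0 isT; pose i3 : 'I_4 := @Ordinal 4 2 isT.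
pose i4 : 'I_4 := @Ordinal 4 3 isT.
have f1 i : f i e1 = (i1 == i)%:R := fE i i1.
have f3 i : f i e3 = (i3 == i)%:R := fE i i3.
have f4 i : f i e4 = (i4 == i)%:R := fE i i4.
have evalE i j k : eval3 (f i) (f j) (f k)
    (e1 \ox e4 \ox e3 + e1 \ox e4 \ox e4 - (e4 \ox e1 \ox e4 - e4 \ox e4 \ox e1)) =
  (i1 == i)%:R * (i4 == j)%:R * (i3 == k)%:R
  + (i1 == i)%:R * (i4 == j)%:R * (i4 == k)%:R
  - ((i4 == i)%:R * (i1 == j)%:R * (i4 == k)%:R
     - (i4 == i)%:R * (i4 == j)%:R * (i1 == k)%:R) :> K.
  have eL := eval3_linear (fL i) (fL j) (fL k).
  by rewrite !(linear_B eL, linear_D eL) !eval3_pure// !f1 !f3 !f4.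
have coefs i j k := prelie_coefficients coproduct0_linear theta_monomial
  coproduct0_leibniz prelie a iterated_coproduct0_2 (fL i) (fL j) (fL k).
have n13 : i1 == i3 = false by [].
have n14 : i1 == i4 = false by [].
have n34 : i3 == i4 = false by [].
have n31 : i3 == i1 = false by [].
have n41 : i4 == i1 = false by [].
have n43 : i4 == i3 = false by [].
(* The only nonzero evaluation is the one in the order 1, 4, 3. It occurs as [eval3 f g h],
   [eval3 g h f] and [eval3 h f g] respectively, leaving one of the three equations each time. *)
split; [have := coefs i1 i4 i3|have := coefs i3 i1 i4|have := coefs i4 i3 i1];
  rewrite !evalE !(eqxx, n13, n14, n34, (n31, n41, n43), (mulr0, mul0r, mulr1, mul1r),
    (subr0, sub0r, addr0, add0r, oppr0), (scale0r, scale1r, scaleN1r, opprK)).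
- by [].
- by move/subr0_eq.
- by move/oppr_inj.
Qed.

End FourDim.

Theorem proposition3p16 (K : fieldType) :
  (forall (P : vectType K) (br bl : {linear P -> tensor P P})
      (Q : int -> vectType K)
      (theta : {linear dsum (fun n => Q n) -> ctensor (fun n => Q n) (fun n => Q n)}),
    zinbiel_dendriform_coalgebra br bl ->
    completed_leibniz_coalgebra theta ->
    completed_prelie_coalgebra (tensor_coproduct br bl theta))
  /\
  (forall (W : vectType K) (e1 e2 e3 e4 : W)
      (theta : {linear dsum (fun n => laurent W n) ->
                  ctensor (fun n => laurent W n) (fun n => laurent W n)}),
    basis_of fullv [:: e1; e2; e3; e4] ->
    (forall n, theta (monomial e1 n) =
       antidiagonal (e1 \ox e4 - e4 \ox e1) n) ->
    (forall n, theta (monomial e2 n) =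
       antidiagonal (e1 \ox e3 + (e1 \ox e4) *+ 2 - e4 \ox e1) n) ->
    (forall n, theta (monomial e3 n) =
       antidiagonal (e4 \ox e3 + e4 \ox e4) n) ->
    (forall n, theta (monomial e4 n) = 0) ->
    completed_leibniz_coalgebra theta /\
    forall (P : lmodType K) (br bl : {linear P -> tensor P P}),
      completed_prelie_coalgebra (tensor_coproduct br bl theta) <->
      zinbiel_dendriform_coalgebra br bl).
Proof.
split=> [P br bl Q theta zd [tc tl]|W e1 e2 e3 e4 theta eB t1 t2 t3 t4].
  exact: prelie_coproduct.
have tm := theta_monomial eB t1 t2 t3 t4.
have wl := coproduct0_leibniz eB t1 t2 t3 t4.
have [tc tl] := laurent_leibniz (coproduct0_linear theta) tm wl.
(* The forward argument of the first part serves here too, with composability and the Leibniz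
   identity supplied by the computation on [W]. *)
split=> // P br bl; split=> [|zd]; last exact: prelie_coproduct.
exact: (prelie_zinbiel eB t1 t2 t3 t4).
Qed.
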